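(* Let $(\mathcal{E}_l)_{l\ge0}$ be a category of smooth objects over a field $K$, and let $\mathcal{E}_{n+m}$ have coordinates $(u,v)=(u_1,\ldots,u_n,v_1,\ldots,v_m)$. Let $\overline{T}$ be any normalized order on $\mathbb{N}^n$. Let $\{f_1(u,v),\ldots,f_k(u,v)\}$ be a finite set of functions in $\mathcal{E}_{n+m}$ for which the initial exponents with respect to $\overline{T}$ exist and $\exp_{\overline T}(f_i(u,0))=\alpha^i$ are the vertices of a diagram $\Delta$ of finite type in $\mathbb{N}^n$; let $\Gamma=\mathbb{N}^n\setminus\Delta$ with associated finite sets $A_j$. Then there is a set of generators of the form $\overline{f_i}=u^{\alpha^i}+r_i$, $i=1,\ldots,k$, of the ideal $(f_1,\ldots,f_k)$ such that $\exp_{\overline T}(\overline{f_i}(u,0))=\alpha^i$ and $\operatorname{supd}(r_i)$ is contained in $\Gamma\times\mathbb{N}^m$. Moreover each $\overline{f_i}$ can be written as a finite sum $$\overline{f_i}=u^{\alpha^i}+\sum_{j=1}^n\sum_{\alpha\in A_j}c_\alpha\cdot u^\alpha,$$ where $c_\alpha\in\mathcal{E}_{n+m-j}(u_{j+1},\ldots,u_n,v)$ for $\alpha\in A_j$, $j=1,\ldots,n$. Furthermore: 1. If $(\mathcal{E}_l)$ is reduced the decomposition is unique. 2. If $\operatorname{ord}(f_i)=|\alpha^i|$ then $\operatorname{ord}(r_i)\geq|\alpha^i|$. 3. $\exp_{\overline T}(\overline{f_i}(u,0))=\alpha^i$.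
   Context: **Category of smooth objects over a field $K$.** For each $n\ge0$ a triple $(\mathcal{E}_n,\{x_1,\ldots,x_n\},m_n)$ such that: (1) $\mathcal{E}_0=K$, $m_0=0$. (2) $\mathcal{E}_n$ is a local ring with maximal ideal $m_n$, containing its residue field $K$. (3) $x_i\in m_n$ and their classes form a basis of $m_n/m_n^2$ over $K$. (4) There is a $K$-algebra homomorphism $T_n:\mathcal{E}_n\to\varprojlim_k\mathcal{E}_n/m_n^k\simeq K[[x_1,\ldots,x_n]]$ with kernel $m_n^\infty=\bigcap_km_n^k$ and $x_i\mapsto x_i$. (5) Any $f_1,\ldots,f_m\in m_n$ define a unique ring homomorphism $f^*:\mathcal{E}_m\to\mathcal{E}_n$ with $f^*(x_i)=f_i$, commuting with the $T$'s (written $g\mapsto g(f_1,\ldots,f_m)$); $(x_1,\ldots,x_n)$ gives the identity, and compositions of such homomorphisms are again of this form. (6) There are derivations $\partial/\partial x_i$ of $\mathcal{E}_n$ commuting with $T_n$ and inducing the standard ones on $K[[x]]$ (in positive characteristic, Hasse derivatives commuting with $T_n$). (7) For $k\le n$ the functions $(x_1,\ldots,x_k)$ define an inclusion $\mathcal{E}_k\subset\mathcal{E}_n$ compatible with the $T$'s and the derivations, with $\mathcal{E}_k=\{f\in\mathcal{E}_n:\partial f/\partial x_i=0,\ i>k\}$ (all Hasse derivatives in $x_i$, $i>k$, in positive characteristic). (8) For $k\le n$, $(x_1,\ldots,x_k,0,\ldots,0)$ defines a surjection $\mathcal{E}_n\to\mathcal{E}_k$ with kernel $(x_{k+1},\ldots,x_n)$.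 (9) If $u_1,\ldots,u_n\in m_n$ and $\det[\partial u_i/\partial x_j](0)\ne0$, the map defined by $(u_1,\ldots,u_n)$ is invertible. (10) For $g(t,x)\in\mathcal{E}_{n+1}$ and $P^d=t^d+y_1t^{d-1}+\ldots+y_d\in\mathcal{E}_{n+d+1}(t,x,y)$ there are $h\in\mathcal{E}_{n+d+1}$ and $r_i\in\mathcal{E}_{n+d}(x,y)$ with $g=hP^d+\sum_{i=0}^{d-1}r_it^i$. The category is reduced if $m_n^\infty=0$ for all $n$. Examples: germs of $C^\infty$ functions at $0\in\mathbb{R}^n$; germs of real or complex analytic functions; henselizations of $K[x_1,\ldots,x_n]_{(x_1,\ldots,x_n)}$; $K[[x_1,\ldots,x_n]]$. $\mathcal{E}_{n+m-j}(u_{j+1},\ldots,u_n,v)\subset\mathcal{E}_{n+m}$ is the subring of functions of the indicated coordinates. **Orders.** A normalized order on $\mathbb{N}^n$ is given by a tuple $\overline{T}=(T_1,\ldots,T_k)$ of linear forms on $\mathbb{R}^n$ with nonnegative coefficients with $T_1=x_1+\ldots+x_n$; $\alpha\le\beta$ iff $\overline{T}(\alpha)\le_{\rm lex}\overline{T}(\beta)$. For $f$ with Taylor series $\sum c_\alpha u^\alpha$, $\exp_{\overline T}(f)$ is the unique exponent with $c_\alpha\ne0$ at which $\overline{T}$ is lexicographically minimal, if it exists. $\operatorname{ord}(f)=\sup\{k:f\in m^k\}$. $f(u,0)$ is the restriction to $v=0$. $\operatorname{supd}(f)=\{\gamma\in\mathbb{N}^{n+m}:D_\gamma f\ne0\}$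 with $D_\gamma=\frac1{\gamma!}\partial^{\gamma}$ the Hasse derivatives in $(u,v)$. $|\alpha|=\sum\alpha_i$. **Diagrams.** A diagram is $\Delta=\bigcup(a_i+\mathbb{N}^n)$ for finitely many $a_i$; its vertices are its minimal generators. It is of finite type if for all $i<j$ and $\alpha\in\Delta$ there is $\alpha'_i\in\mathbb{N}$ such that replacing the $i$-th coordinate of $\alpha$ by $\alpha_i+\alpha_i'$ and the $j$-th by $0$ gives an element of $\Delta$. With $\pi_{n,j}:\mathbb{N}^n\to\mathbb{N}^j$ the projection to the first $j$ coordinates, $\overline{\Gamma}^j=\mathbb{N}^j\setminus\pi_{n,j}(\Delta)$ and $A_j=\overline{\Gamma}^j\setminus(\overline{\Gamma}^{j-1}\times\mathbb{N})\subset\mathbb{N}^j=\mathbb{N}^j\times\{0\}\subset\mathbb{N}^n$; then $\Gamma=\bigsqcup_jA_j\times\mathbb{N}^{n-j}$ and the $A_j$ are finite.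
   Formalization: In 2, ord(f_i)=|α^i| is assumed for all i at once; in (6) the derivations commute and ∂x_j/∂x_i=δ_ij exactly; (7) is assumed for any k of the coordinates, not only the first k; in 1, unique means that f̄_i determines its coefficients c_α. *)

(* Defs.v *)
From HB Require Import structures.
From mathcomp Require Import all_boot all_order all_algebra.
From mathcomp Require Import finmap boolp classical_sets functions reals mpoly.

Set Implicit Arguments.
Unset Strict Implicit.
Unset Printing Implicit Defensive.

Import Order.TTheory GRing.Theory.
Local Open Scope ring_scope.

(* A power series is the family of its coefficients.  The alias carries the
   Cauchy product, not the pointwise product of the function space. *)
Definition mpseries (n : nat) (K : fieldType) : Type := 'X_{1..n} -> K.

Section PowerSeriesRing.
Variables (n : nat) (K : fieldType).
Local Notation mps := (mpseries n K).

HB.instance Definition _ := GRing.Zmodule.copy mps ('X_{1..n} -> K).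

Definition mps_scale (a : K) (F : mps) : mps := fun g => a * F g.
Definition mps_one : mps := fun g => (g == 0%MM)%:R.
Definition mps_mul (F G : mps) : mps := fun g =>
  \sum_(k : 'X_{1..n < (mdeg g).+1, (mdeg g).+1} | g == (k.1 + k.2)%MM)
     F k.1 * G k.2.

Let trunc (d : nat) (F : mps) : {mpoly K[n]} :=
  \sum_(k : 'X_{1..n < d}) F k *: 'X_[k].

Let truncE d F g : (mdeg g < d)%N -> (trunc d F)@_g = F g.
Proof. by move=> lt_gd; rewrite /trunc mcoeff_mpoly. Qed.

Let mps_mulE d F G g : (mdeg g < d)%N ->
  mps_mul F G g = (trunc d F * trunc d G)@_g.
Proof.
move=> lt_gd; rewrite mcoeffM; apply: eq_bigr => -[k1 k2] /= /eqP eg.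
have eD : mdeg g = (mdeg k1 + mdeg k2)%N by rewrite [in LHS]eg mdegD.
have le1 : (mdeg k1 <= mdeg g)%N by rewrite [leqRHS]eD leq_addr.
have le2 : (mdeg k2 <= mdeg g)%N by rewrite [leqRHS]eD leq_addl.
by rewrite !truncE // (leq_ltn_trans _ lt_gd).
Qed.

Let mulr_coef_ext (p p' q q' : {mpoly K[n]}) g :
    (forall k, (mdeg k <= mdeg g)%N -> p@_k = p'@_k) ->
    (forall k, (mdeg k <= mdeg g)%N -> q@_k = q'@_k) ->
  (p * q)@_g = (p' * q')@_g.
Proof.
move=> ep eq; rewrite !mcoeffM; apply: eq_bigr => -[k1 k2] /= /eqP eg.
have eD : mdeg g = (mdeg k1 + mdeg k2)%N by rewrite [in LHS]eg mdegD.
by rewrite ep ?eq // [leqRHS]eD ?leq_addr ?leq_addl.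
Qed.

Let mps_mulA : associative mps_mul.
Proof.
move=> F G H; apply: funext => g; pose d := (mdeg g).+1.
rewrite !(@mps_mulE d) //.
transitivity (trunc d F * (trunc d G * trunc d H))@_g.
  apply: mulr_coef_ext => // k le_k.
  by rewrite truncE ?ltnS // (@mps_mulE d) ?ltnS.
rewrite mulrA; apply: mulr_coef_ext => // k le_k.
by rewrite truncE ?ltnS // (@mps_mulE d) ?ltnS.
Qed.

Let mps_mulC : commutative mps_mul.
Proof.
by move=> F G; apply: funext => g; rewrite !(@mps_mulE (mdeg g).+1) // mulrC.
Qed.

Let mps_mul1 : left_id mps_one mps_mul.
Proof.
move=> F; apply: funext => g; rewrite (@mps_mulE (mdeg g).+1) //.
rewrite (@mulr_coef_ext _ 1 _ (trunc (mdeg g).+1 F)) ?mul1r ?truncE // => k le_k.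
by rewrite truncE ?ltnS // mcoeff1.
Qed.

Let mps_mulDl : left_distributive mps_mul +%R.
Proof.
move=> F G H; apply: funext => g; rewrite /GRing.add /= /mps_mul -big_split /=.
by apply: eq_bigr => k _; rewrite mulrDl.
Qed.

Let mps_oner_neq0 : mps_one != 0.
Proof.
apply/eqP => /(congr1 (fun F : mps => F 0%MM)).
by rewrite /mps_one eqxx => /eqP; rewrite oner_eq0.
Qed.

HB.instance Definition _ := GRing.Zmodule_isComNzRing.Build mps
  mps_mulA mps_mulC mps_mul1 mps_mulDl mps_oner_neq0.

Let mps_scaleA a b (F : mps) : mps_scale a (mps_scale b F) = mps_scale (a * b) F.
Proof. by apply: funext => g; rewrite /mps_scale mulrA. Qed.

Let mps_scale1 : left_id 1 mps_scale.
Proof. by move=> F; apply: funext => g; rewrite /mps_scale mul1r. Qed.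

Let mps_scaleDr : right_distributive mps_scale +%R.
Proof. by move=> a F G; apply: funext => g; rewrite /mps_scale mulrDr. Qed.

Let mps_scaleDl F : {morph mps_scale^~ F : a b / a + b}.
Proof. by move=> a b; apply: funext => g; rewrite /mps_scale mulrDl. Qed.

HB.instance Definition _ := GRing.Zmodule_isLmodule.Build K mps
  mps_scaleA mps_scale1 mps_scaleDr mps_scaleDl.

Let mps_scaleAl a (F G : mps) : a *: (F * G) = (a *: F) * G.
Proof.
apply: funext => g; rewrite /GRing.scale /GRing.mul /= /mps_scale /mps_mul.
by rewrite mulr_sumr; apply: eq_bigr => k _; rewrite mulrA.
Qed.

HB.instance Definition _ := GRing.Lmodule_isLalgebra.Build K mps mps_scaleAl.
HB.instance Definition _ := GRing.Lalgebra_isComAlgebra.Build K mps.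

Definition mps_var (i : 'I_n) : mps := fun g => (g == U_(i)%MM)%:R.

(* D_d (sum_g F_g x^g) = sum_g binom(g, d) F_g x^(g - d) *)
Definition mps_hasse (d : 'X_{1..n}) (F : mps) : mps := fun g =>
  (\prod_(i < n) 'C(g i + d i, d i))%:R * F (g + d)%MM.

End PowerSeriesRing.

(* F(G_1, ..., G_m), for series G_i without constant term: the product
   G^b then has order >= |b|, so only the b with |b| <= |g| contribute to the
   coefficient of x^g. *)
Definition mps_comp (K : fieldType) (m n : nat)
    (F : mpseries m K) (G : 'I_m -> mpseries n K) : mpseries n K := fun g =>
  \sum_(b : 'X_{1..m < (mdeg g).+1}) F b * (\prod_(i < m) G i ^+ b i) g.

Definition ideal_gen (A : comNzRingType) (k : nat) (g : 'I_k -> A) (f : A) : Prop :=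
  exists h : 'I_k -> A, f = \sum_(i < k) h i * g i.

(* I^k, as the set of finite sums of terms b * (a_1 * ... * a_k), a_i \in I *)
Definition ideal_pow (A : comNzRingType) (I : {pred A}) (k : nat) (f : A) : Prop :=
  exists s : seq (A * k.-tuple A),
    (forall t, t \in s -> {subset t.2 <= I}) /\
    f = \sum_(t <- s) t.1 * \prod_(a <- t.2) a.

(* Coordinates of E_(1+n+d) = E(t, x_1..x_n, y_1..y_d). *)
Definition ord_t n d : 'I_(1 + n + d) := lshift d (lshift n ord0).
Definition ord_y n d (i : 'I_d) : 'I_(1 + n + d) := rshift (1 + n) i.
Definition ord_tx n d (i : 'I_(1 + n)) : 'I_(1 + n + d) := lshift d i.
Definition ord_xy n d (i : 'I_(n + d)) : 'I_(1 + n + d) :=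
  match fintype.split i with
  | inl a => lshift d (rshift 1 a)
  | inr b => rshift (1 + n) b
  end.

(* obj n is E_n, and var i is its coordinate x_i. *)
Record smooth_data (K : fieldType) := SmoothData {
  obj : nat -> comUnitAlgType K;
  var : forall n, 'I_n -> obj n;
  maxid : forall n, {pred obj n};
  taylor : forall n, {lrmorphism obj n -> mpseries n K};
  (* subst f g = g(f_1, ..., f_m); only meaningful when all f_i are in the
     maximal ideal, and constrained in that case only. *)
  subst : forall m n, ('I_m -> obj n) -> {lrmorphism obj m -> obj n};
  (* hasse g is D_g = 1/g! d^g; in particular hasse U_(i) is d/dx_i. *)
  hasse : forall n, 'X_{1..n} -> obj n -> obj n
}.

Arguments var {K s n}.
Arguments maxid {K} s n.
Arguments taylor {K s n}.
Arguments subst {K s m n}.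
Arguments hasse {K s n}.

Section Coordinates.
Variables (K : fieldType) (C : smooth_data K).

(* f |-> f(x_(s 1), ..., x_(s k)) *)
Definition coord k n (s : 'I_k -> 'I_n) : {lrmorphism obj C k -> obj C n} :=
  subst (fun i => var (s i)).

(* f |-> f(x_1, ..., x_k, 0, ..., 0) *)
Definition restr k l : {lrmorphism obj C (k + l) -> obj C k} :=
  subst (fun i : 'I_(k + l) =>
    match fintype.split i with inl a => var a | inr _ => 0 end).

End Coordinates.
Arguments coord {K C k n}.
Arguments restr {K C k l}.

Record smooth_category (K : fieldType) := SmoothCategory {
  sdata :> smooth_data K;

  obj0 : bijective (fun c : K => c%:A : obj sdata 0);
  maxid0 : forall f : obj sdata 0, f \in maxid sdata 0 -> f = 0;

  maxid_ideal : forall n, idealr_closed (maxid sdata n);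
  maxid_local : forall n (f : obj sdata n), f \notin maxid sdata n -> f \is a GRing.unit;
  maxid_residue : forall n (f : obj sdata n), exists c : K, f - c%:A \in maxid sdata n;

  var_maxid : forall n (i : 'I_n), (var i : obj sdata n) \in maxid sdata n;
  var_basis : forall n (f : obj sdata n), f \in maxid sdata n ->
    exists! c : {ffun 'I_n -> K},
      ideal_pow (maxid sdata n) 2 (f - \sum_(i < n) c i *: var i);

  taylor_var : forall n (i : 'I_n), taylor (var i : obj sdata n) = mps_var K i;
  taylor_ker : forall n (f : obj sdata n),
    taylor f = 0 <-> forall k, ideal_pow (maxid sdata n) k f;
  (* Taylor expansion induces isomorphisms E_n/m_n^k ~ K[[x]]/(x)^k (they are
     onto, as the image of E_n contains the polynomials), hence
     lim_k E_n/m_n^k ~ K[[x]], compatibly with the map from E_n to the limit. *)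
  taylor_adic : forall n (f : obj sdata n) k,
    ideal_pow (maxid sdata n) k f <-> forall g, (mdeg g < k)%N -> taylor f g = 0;

  subst_var : forall m n (f : 'I_m -> obj sdata n), (forall i, f i \in maxid sdata n) ->
    forall i, subst f (var i) = f i;
  subst_taylor : forall m n (f : 'I_m -> obj sdata n),
    (forall i, f i \in maxid sdata n) ->
    forall g, taylor (subst f g) = mps_comp (taylor g) (fun i => taylor (f i));
  subst_unique : forall m n (f : 'I_m -> obj sdata n),
    (forall i, f i \in maxid sdata n) ->
    forall phi : {lrmorphism obj sdata m -> obj sdata n},
      (forall i, phi (var i) = f i) ->
      (forall g, taylor (phi g) = mps_comp (taylor g) (fun i => taylor (f i))) ->
    forall g, phi g = subst f g;
  subst_id : forall n (g : obj sdata n), subst var g = g;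
  subst_comp : forall l m n (h : 'I_l -> obj sdata m) (f : 'I_m -> obj sdata n),
    (forall i, h i \in maxid sdata m) -> (forall i, f i \in maxid sdata n) ->
    forall g, subst f (subst h g) = subst (fun i => subst f (h i)) g;

  (* In characteristic 0 the next five laws say exactly that the hasse U_(i)
     are commuting K-derivations with d x_j/dx_i = delta_ij, and that
     hasse g = 1/g! d^g. *)
  hasse_linear : forall n g (a : K) (f h : obj sdata n),
    hasse g (a *: f + h) = a *: hasse g f + hasse g h;
  hasse_id : forall n (f : obj sdata n), hasse 0%MM f = f;
  hasse_leibniz : forall n g (f h : obj sdata n),
    hasse g (f * h)
    = \sum_(k : 'X_{1..n < (mdeg g).+1, (mdeg g).+1} | g == (k.1 + k.2)%MM)
        hasse k.1 f * hasse k.2 h;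
  hasse_comp : forall n g g' (f : obj sdata n),
    hasse g (hasse g' f)
    = (\prod_(i < n) 'C(g i + g' i, g i))%:R *: hasse (g + g')%MM f;
  hasse_var : forall n g (i : 'I_n), g != 0%MM ->
    hasse g (var i : obj sdata n) = (g == U_(i)%MM)%:R;
  hasse_taylor : forall n g (f : obj sdata n),
    taylor (hasse g f) = mps_hasse g (taylor f);

  (* The coordinates of E_n form an unordered set, so
     that any k of them may be used, not only the first k.  Compatibility with
     Taylor expansion is subst_taylor. *)
  coord_inj : forall k n (s : 'I_k -> 'I_n), injective s ->
    injective (coord s : obj sdata k -> obj sdata n);
  coord_hasse : forall k n (s : 'I_k -> 'I_n), injective s ->
    forall (g : 'X_{1..k}) (f : obj sdata k),
    hasse [multinom (\sum_(i < k | s i == j) g i)%N | j < n] (coord s f)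
    = coord s (hasse g f);
  coord_image : forall k n (s : 'I_k -> 'I_n), injective s ->
    forall f : obj sdata n,
    (exists f' : obj sdata k, f = coord s f') <->
    (forall j, j \notin codom s ->
       forall p, (0 < p)%N -> hasse (U_(j) *+ p)%MM f = 0);

  restr_surj : forall k l (g : obj sdata k), exists f : obj sdata (k + l), restr f = g;
  restr_ker : forall k l (f : obj sdata (k + l)),
    restr f = 0 <-> ideal_gen (fun j : 'I_l => var (rshift k j)) f;

  subst_inverse : forall n (u : 'I_n -> obj sdata n),
    (forall i, u i \in maxid sdata n) ->
    taylor (\det (\matrix_(i < n, j < n) hasse U_(j)%MM (u i))) 0%MM != 0 ->
    exists w : 'I_n -> obj sdata n, (forall i, w i \in maxid sdata n) /\
      cancel (subst u) (subst w) /\ cancel (subst w) (subst u);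

  generic_division : forall n d (g : obj sdata (1 + n)),
    let t := var (ord_t n d) in
    let P := t ^+ d + \sum_(i < d) var (ord_y n i) * t ^+ (d - i.+1) in
    exists (h : obj sdata (1 + n + d)) (r : 'I_d -> obj sdata (n + d)),
      coord (@ord_tx n d) g
      = h * P + \sum_(i < d) coord (@ord_xy n d) (r i) * t ^+ i
}.

Definition reduced (K : fieldType) (C : smooth_category K) : Prop :=
  forall n (f : obj C n), (forall k, ideal_pow (maxid C n) k f) -> f = 0.

(* ord f = sup {k | f \in m^k} is taken in N u {oo}: it equals d : nat iff d is
   the greatest such k, and is >= d iff some such k is. *)
Definition ord_eq (K : fieldType) (C : smooth_category K) n (f : obj C n) (d : nat) :=
  ideal_pow (maxid C n) d f /\
  forall k, ideal_pow (maxid C n) k f -> (k <= d)%N.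
Definition ord_ge (K : fieldType) (C : smooth_category K) n (f : obj C n) (d : nat) :=
  exists2 k, (d <= k)%N & ideal_pow (maxid C n) k f.

Lemma coord_from_subproof (N j : nat) (i : 'I_(N - j)) : (j + i < N)%N.
Proof. by rewrite -ltn_subRL. Qed.

(* f belongs to E_(N-j)(x_(j+1), ..., x_N) \subset E_N *)
Definition coord_from (K : fieldType) (C : smooth_category K) N (j : nat)
    (f : obj C N) : Prop :=
  exists f' : obj C (N - j),
    f = coord (fun i => Ordinal (coord_from_subproof i)) f'.

(* u^a in E_(n+m), with coordinates (u, v) = (u_1, ..., u_n, v_1, ..., v_m) *)
Definition umonom (K : fieldType) (C : smooth_category K) n m (a : 'X_{1..n}) :
    obj C (n + m) :=
  \prod_(i < n) var (lshift m i) ^+ a i.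

(* supd f \subset G x N^m *)
Definition supd_sub (K : fieldType) (C : smooth_category K) n m
    (f : obj C (n + m)) (G : 'X_{1..n} -> Prop) : Prop :=
  forall g : 'X_{1..n + m}, hasse g f <> 0 ->
    G [multinom g (lshift m i) | i < n].

(* The rows of T are the linear forms T_1, ..., T_k (k >= 1). *)
Definition normalized_order (R : realType) k n (T : 'M[R]_(k.+1, n)) : Prop :=
  (forall i j, 0 <= T i j) /\ (forall j, T ord0 j = 1).

Definition weight (R : realType) k n (T : 'M[R]_(k, n)) (a : 'X_{1..n}) :
    k.-tuplelexi R :=
  [tuple \sum_(j < n) T i j * (a j)%:R | i < k].

Definition initial_exponent (R : realType) k n (T : 'M[R]_(k, n)) (K : fieldType)
    (F : mpseries n K) (a : 'X_{1..n}) : Prop :=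
  F a <> 0 /\ forall b, F b <> 0 -> (weight T a <= weight T b)%O.

(* a = exp_T(F) *)
Definition is_exp (R : realType) k n (T : 'M[R]_(k, n)) (K : fieldType)
    (F : mpseries n K) (a : 'X_{1..n}) : Prop :=
  unique (initial_exponent T F) a.

Definition diagram n (D : 'X_{1..n} -> Prop) : Prop :=
  exists s : seq 'X_{1..n}, forall b, D b <-> exists2 a, a \in s & (a <= b)%MM.

Definition vertex n (D : 'X_{1..n} -> Prop) (a : 'X_{1..n}) : Prop :=
  D a /\ forall b, D b -> (b <= a)%MM -> b = a.

Definition finite_type n (D : 'X_{1..n} -> Prop) : Prop :=
  forall i j : 'I_n, (i < j)%N -> forall a, D a ->
    exists p : nat,
      D [multinom (if l == i then a l + p else if l == j then 0 else a l)%N | l < n].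

(* pi_(n,j), with N^j identified with N^j x {0} \subset N^n *)
Definition proj n (j : nat) (a : 'X_{1..n}) : 'X_{1..n} :=
  [multinom (if (i < j)%N then a i else 0)%N | i < n].

Definition Gamma_bar n (D : 'X_{1..n} -> Prop) (j : nat) (b : 'X_{1..n}) : Prop :=
  proj j b = b /\ ~ exists2 a, D a & proj j a = b.

(* A_j = Gamma_bar^j \ (Gamma_bar^(j-1) x N), for 1 <= j <= n *)
Definition Aset n (D : 'X_{1..n} -> Prop) (j : nat) (b : 'X_{1..n}) : Prop :=
  Gamma_bar D j b /\ ~ Gamma_bar D j.-1 (proj j.-1 b).

(* Main.v *)
From HB Require Import structures.
Require Import Defs.
From mathcomp Require Import all_boot all_order all_algebra all_fingroup.
From mathcomp Require Import finmap boolp reals mpoly.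

(** The heart of the matter is a division theorem: every element of E_(n+m) is a
    sum of products h g over finitely many cones (l, mu, g), where h depends
    only on the coordinates of index at least l, g has initial monomial mu, and
    the sets mu + N^(coordinates of index at least l) are pairwise disjoint.  In
    each cone g is either u^mu with mu in one of the sets A_l, or a monomial
    multiple of some f_i.  Dividing u^(alpha_i) splits it into an element fbar_i of
    the ideal and a remainder - r_i of the required shape.

    The division (lemma division) treats one coordinate at a time.  After j
    coordinates the cones that are not yet final are u^beta E(u_(j+1), .., u_n, v)
    for finitely many beta in N^j.  Put t = u_(j+1).  As the diagram is of finite
    type, some beta + d e_t lies in it for each beta, hence a monomial multiple of
    some f_i has this initial monomial; dividing it by the cones already found
    gives a relation between the generators u^beta.  In the Leibniz expansion of
    the determinant of these relations exactly one term attains the minimal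
    monomial, so the determinant is regular in t (lead_det).  It annihilates the
    quotient module, so Weierstrass division makes that module finitely generated
    over E(u_(j+2), .., u_n, v) by the t^s u^beta, and a system that is
    triangular modulo the maximal ideal discards those with s >= d (malgrange_step).
    Weierstrass division by an element regular in t (weierstrass_division) comes
    from generic division by a polynomial with indeterminate coefficients y: the
    implicit function theorem finds values of y at which the remainder of the
    divisor vanishes.

    Initial exponents are controlled by comparing leading monomials: since the
    cones are disjoint, the smallest of the leading monomials of the h g cannot
    cancel in their sum (taylor_cone, below_initial).  This applies to any
    additive well-order on the monomials of E_(n+m) for which each f_i has initial
    monomial u^(alpha_i).  Ordering by the v-degree and then by T gives the initial
    exponent of fbar_i(u, 0), and shows that the matrix expressing the fbar_i
    through the f_j is triangular modulo the maximal ideal, so that both families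
    generate the same ideal (normal_forms_generate).  Ordering by the total degree
    first bounds the order of r_i from below.  Uniqueness in the reduced case is
    the absence of cancellation for a sum equal to zero. *)

Set Implicit Arguments.
Unset Strict Implicit.
Unset Printing Implicit Defensive.

Import Order.TTheory GRing.Theory Num.Theory.
Local Open Scope ring_scope.
Local Notation coord := Defs.coord.

(** * Coefficients of formal power series *)

Section SeriesCoefficients.
Variables (n : nat) (K : fieldType).
Implicit Types (F G : mpseries n K) (a b g : 'X_{1..n}).

Lemma mps_mulE F G g : (F * G) g =
  \sum_(k : 'X_{1..n < (mdeg g).+1, (mdeg g).+1} | g == (k.1 + k.2)%MM)
     F k.1 * G k.2.
Proof. by []. Qed.

Lemma mps_sumE (I : Type) (r : seq I) (P : pred I) (F : I -> mpseries n K) g :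
  (\sum_(i <- r | P i) F i) g = \sum_(i <- r | P i) F i g.
Proof. by elim/big_rec2: _ => // i x y _ <-. Qed.

Lemma mps_mul_neq0 F G g : (F * G) g != 0 ->
  exists a b, [/\ g = (a + b)%MM, F a != 0 & G b != 0].
Proof.
rewrite mps_mulE => h.
have [k /andP [/eqP eg h']] : exists k : 'X_{1..n < (mdeg g).+1, (mdeg g).+1},
    (g == (k.1 + k.2)%MM) && (F k.1 * G k.2 != 0).
  apply/existsP; apply: contraNT h => /existsPn h; rewrite big1 // => k hk.
  by move: (h k); rewrite hk /= negbK => /eqP.
by exists k.1, k.2; split => //; apply: contraNneq h' => ->; rewrite (mul0r, mulr0).
Qed.

Lemma mps_mul_single F G a b :
  (forall a' b', (a + b)%MM = (a' + b')%MM -> F a' != 0 -> G b' != 0 -> a' = a) ->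
  (F * G) (a + b)%MM = F a * G b.
Proof.
move=> h; rewrite mps_mulE.
have ha : (mdeg a < (mdeg (a + b)).+1)%N by rewrite ltnS mdegD leq_addr.
have hb : (mdeg b < (mdeg (a + b)).+1)%N by rewrite ltnS mdegD leq_addl.
rewrite (bigD1 (BMultinom ha, BMultinom hb)) //= big1 ?addr0 // => -[k1 k2] /=.
case/andP => /eqP e; apply: contraNeq => h'.
have e1 : (k1 : 'X_{1..n}) = a.
  by apply: (h _ _ e); apply: contraNneq h' => ->; rewrite (mul0r, mulr0).
have e2 : (k2 : 'X_{1..n}) = b by apply/esym/(@addmI _ a); apply: (etrans e); rewrite e1.
apply/eqP; congr pair; apply: val_inj => /=; [exact: e1 | exact: e2].
Qed.

Lemma mps_mul_const F G : (F * G) 0%MM = F 0%MM * G 0%MM.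
Proof.
have := @mps_mul_single F G 0%MM 0%MM; rewrite addm0; apply => a' b' /esym/eqP.
by rewrite mnmD_eq0 => /andP [/eqP -> _].
Qed.

Definition mps_const F : K := F 0%MM.

Lemma mps_const_is_zmod : zmod_morphism mps_const.
Proof. by []. Qed.
Lemma mps_const_is_monoid : monoid_morphism mps_const.
Proof. by split; [rewrite /mps_const /GRing.one /= /mps_one eqxx | exact: mps_mul_const]. Qed.
HB.instance Definition _ :=
  GRing.isZmodMorphism.Build (mpseries n K) K mps_const mps_const_is_zmod.
HB.instance Definition _ :=
  GRing.isMonoidMorphism.Build (mpseries n K) K mps_const mps_const_is_monoid.

Definition mps_monom a : mpseries n K := fun g => (g == a)%:R.

Lemma mps_monomD a b : mps_monom a * mps_monom b = mps_monom (a + b).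
Proof.
apply: funext => g; have [->|ne] := eqVneq g (a + b)%MM.
  rewrite mps_mul_single ?/mps_monom ?eqxx ?mulr1 // => a' b' _.
  by have [//|] := eqVneq a' a; rewrite eqxx.
rewrite [RHS]/mps_monom (negPf ne); apply: contraNeq ne => /mps_mul_neq0 [a' [b' []]].
rewrite /mps_monom => -> ; have [->|] := eqVneq a' a; last by rewrite eqxx.
by have [->|] := eqVneq b' b; last by rewrite eqxx.
Qed.

Lemma mps_monom0 : mps_monom 0 = 1.
Proof. by []. Qed.

Lemma mps_mul_monom F a g : (F * mps_monom a) g = if (a <= g)%MM then F (g - a)%MM else 0.
Proof.
case: ifPn => [le_ag | nle].
  rewrite -{1}(submK le_ag) mps_mul_single; first by rewrite /mps_monom eqxx mulr1.
  move=> a' b' e _; rewrite /mps_monom; have [eb _|] := eqVneq b' a; last by rewrite eqxx.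
  by move: e; rewrite eb => /addIm.
apply: contraNeq nle => /mps_mul_neq0 [a' [b' [-> _]]].
by rewrite /mps_monom; have [->|] := eqVneq b' a; [rewrite lem_addl | rewrite eqxx].
Qed.

Lemma mps_varE (i : 'I_n) : mps_var K i = mps_monom U_(i).
Proof. by []. Qed.

End SeriesCoefficients.

(** * Constant terms, coordinates and monomials in a smooth category *)

Section Basics.
Variables (K : fieldType) (C : smooth_category K).

Definition res n (f : obj C n) : K := mps_const (taylor f).
HB.instance Definition _ n := GRing.RMorphism.copy (@res n) (@mps_const n K \o taylor).

Lemma resE n (f : obj C n) : res f = taylor f 0%MM. Proof. by []. Qed.

Lemma taylorD n (f g : obj C n) a : taylor (f + g) a = taylor f a + taylor g a.
Proof. by rewrite raddfD. Qed.

Lemma taylor_sum n (I : Type) (r : seq I) (P : pred I) (F : I -> obj C n) a :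
  taylor (\sum_(i <- r | P i) F i) a = \sum_(i <- r | P i) taylor (F i) a.
Proof. by rewrite raddf_sum mps_sumE. Qed.

Lemma maxid_res n (f : obj C n) : f \in maxid C n <-> res f = 0.
Proof.
have h := @taylor_adic _ C n f 1; split => [hf | hf].
  have [h1 _] := h; apply: h1; last by rewrite mdeg0.
  exists [:: (1, [tuple f])]; split; last by rewrite big_seq1 /= big_seq1 mul1r.
  by move=> t; rewrite inE => /eqP -> x /=; rewrite inE => /eqP ->.
have [|s [hs ->]] := (proj2 h).
  by move=> g; rewrite ltnS leqn0 mdeg_eq0 => /eqP ->.
have [h0 h1 hid] := maxid_ideal C n.
have hD : forall x y, x \in maxid C n -> y \in maxid C n -> x + y \in maxid C n.
  by move=> x y hx hy; rewrite -[x]mul1r; apply: hid.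
rewrite big_seq; elim/big_rec: _ => [|[a [t /= ht]] y /hs hin hy]; first exact: h0.
case: t ht hin => [//|b [|//]] ht hin; rewrite /= big_seq1 hD //.
by rewrite -[a * b]addr0; apply: hid => //; apply: hin; rewrite inE.
Qed.

Lemma res_unit n (f : obj C n) : res f != 0 -> f \is a GRing.unit.
Proof.
move=> h; apply: maxid_local; apply/negP => /maxid_res e.
by rewrite e eqxx in h.
Qed.

Lemma res_var n (i : 'I_n) : res (var i : obj C n) = 0.
Proof. by apply/maxid_res; exact: var_maxid. Qed.

Lemma hasse_res n g (f : obj C n) : res (hasse g f) = taylor f g.
Proof.
rewrite resE hasse_taylor /mps_hasse add0m big1 ?mul1r // => i _.
by rewrite mnm0E add0n binn.
Qed.

Section Subst.
Variables (m n : nat) (f : 'I_m -> obj C n).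
Hypothesis hf : forall i, res (f i) = 0.
Let hm i : f i \in maxid C n. Proof. exact/maxid_res. Qed.

Lemma substX i : subst f (var i) = f i. Proof. exact: subst_var. Qed.

Lemma subst_res g : res (subst f g) = res g.
Proof.
rewrite !resE subst_taylor // /mps_comp mdeg0.
rewrite (bigD1 (@bm0 m 0)) //= [X in _ + X]big1 => [|b]; last first.
  by rewrite -val_eqE /= -mdeg_eq0 -leqn0 -ltnS bmdeg.
rewrite addr0 big1 => [|i _]; last by rewrite mnm0E expr0.
by rewrite /GRing.one /= /mps_one eqxx mulr1.
Qed.

Lemma subst_subst l (h : 'I_l -> obj C m) : (forall i, res (h i) = 0) ->
  forall g, subst f (subst h g) = subst (fun i => subst f (h i)) g.
Proof. by move=> hh; apply: subst_comp => // i; apply/maxid_res. Qed.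
End Subst.

Section Coord.
Variables (k n : nat) (s : 'I_k -> 'I_n).

Lemma coordX i : coord s (var i : obj C k) = var (s i).
Proof. by rewrite /coord substX // => j; exact: res_var. Qed.

Lemma coord_res (f : obj C k) : res (coord s f) = res f.
Proof. by apply: subst_res => i; exact: res_var. Qed.

Lemma subst_coord l (f : 'I_n -> obj C l) (hf : forall i, res (f i) = 0) g :
  subst f (coord s g) = subst (fun i => f (s i)) g.
Proof.
rewrite /coord subst_subst // => [|i]; last exact: res_var.
by congr (subst _ _); apply: funext => i; rewrite substX.
Qed.

Definition mpush (g : 'X_{1..k}) : 'X_{1..n} :=
  [multinom (\sum_(i < k | s i == j) g i)%N | j < n].

Hypothesis s_inj : injective s.

Lemma mpush_in g i : mpush g (s i) = g i.
Proof. by rewrite mnmE (big_pred1 i) // => j; rewrite /= (inj_eq s_inj). Qed.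

Lemma mpush_out g j : j \notin codom s -> mpush g j = 0%N.
Proof.
by move=> h; rewrite mnmE big_pred0 // => i; apply: contraNF h => /eqP <-; exact: codom_f.
Qed.

Lemma mpushP (g : 'X_{1..k}) (b : 'X_{1..n}) : (forall i, b (s i) = g i) ->
  (forall j, j \notin codom s -> b j = 0%N) -> b = mpush g.
Proof.
move=> h1 h2; apply/mnmP => j; have [/codomP [i ->]|hj] := boolP (j \in codom s).
  by rewrite mpush_in.
by rewrite mpush_out // h2.
Qed.

Lemma mpushMU i p : mpush (U_(i) *+ p)%MM = (U_(s i) *+ p)%MM.
Proof.
apply/esym/mpushP => [j|j hj]; rewrite !mulmnE !mnm1E ?(inj_eq s_inj) //.
by case: eqP hj => // <-; rewrite codom_f.
Qed.

Lemma mpush1 i : mpush U_(i)%MM = U_(s i)%MM.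
Proof. by have := mpushMU i 1; rewrite !mulm1n. Qed.

Lemma coord_taylor (f : obj C k) g : taylor (coord s f) (mpush g) = taylor f g.
Proof. by rewrite -!hasse_res coord_hasse // coord_res. Qed.

End Coord.

Lemma hasseD n g (a b : obj C n) : hasse g (a + b) = hasse g a + hasse g b.
Proof. by have := hasse_linear g 1 a b; rewrite !scale1r. Qed.

Lemma hasse0 n g : hasse g (0 : obj C n) = 0.
Proof. by apply: (addrI (hasse g 0)); rewrite -hasseD !addr0. Qed.

(** If all higher derivatives in the j-th coordinate vanish, every derivative
    that involves it vanishes, because it factors through one of them. *)
Lemma hasse_indep n (f : obj C n) (j : 'I_n) :
  (forall p, (0 < p)%N -> hasse (U_(j) *+ p)%MM f = 0) ->
  forall g, hasse g f <> 0 -> g j = 0%N.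
Proof.
move=> h g hg; apply/eqP; rewrite -leqn0 leqNgt; apply/negP => hj; apply: hg.
pose b := [multinom (if i == j then 0 else g i)%N | i < n].
have e : g = (b + U_(j) *+ g j)%MM.
  apply/mnmP => i; rewrite mnmDE mulmnE mnm1E mnmE (eq_sym j i).
  by case: eqP => [->|_]; rewrite (mul1n, mul0n) ?add0n ?addn0.
have := hasse_comp b (U_(j) *+ g j)%MM f.
rewrite -e h // hasse0 big1 => [|i _]; first by rewrite scale1r => <-.
rewrite mulmnE mnm1E mnmE (eq_sym j i).
by case: eqP => _; rewrite ?bin0 // mul0n addn0 binn.
Qed.

Lemma hasseM_neq0 n g (a b : obj C n) : hasse g (a * b) <> 0 ->
  exists g1 g2, [/\ g = (g1 + g2)%MM, hasse g1 a <> 0 & hasse g2 b <> 0].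
Proof.
move/eqP; rewrite hasse_leibniz => h.
have [k /andP [/eqP eg h']] : exists k : 'X_{1..n < (mdeg g).+1, (mdeg g).+1},
    (g == (k.1 + k.2)%MM) && (hasse k.1 a * hasse k.2 b != 0).
  apply/existsP; apply: contraNT h => /existsPn h; rewrite big1 // => k hk.
  by move: (h k); rewrite hk /= negbK => /eqP.
exists k.1, k.2; split => // e; move: h'; rewrite e (mul0r, mulr0) eqxx //.
Qed.

Definition monom n (a : 'X_{1..n}) : obj C n := \prod_(i < n) var i ^+ a i.

Lemma monom0 n : monom (0%MM : 'X_{1..n}) = 1.
Proof. by rewrite /monom big1 // => i _; rewrite mnm0E. Qed.

Lemma monomD n (a b : 'X_{1..n}) : monom (a + b) = monom a * monom b.
Proof. by rewrite /monom -big_split; apply: eq_bigr => i _; rewrite mnmDE exprD. Qed.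

Lemma monomMU n (i : 'I_n) p : monom (U_(i) *+ p)%MM = var i ^+ p.
Proof.
rewrite /monom (bigD1 i) //= big1 ?mulr1 => [|j]; rewrite mulmnE mnm1E ?eqxx ?mul1n //.
by rewrite eq_sym => /negPf ->.
Qed.

Lemma taylor_monom n (a : 'X_{1..n}) : taylor (monom a) = mps_monom K a.
Proof.
have pw (i : 'I_n) p : mps_var K i ^+ p = mps_monom K (U_(i) *+ p)%MM.
  elim: p => [|p IH]; first by rewrite expr0 mulm0n.
  by rewrite exprSr IH mps_varE mps_monomD mulmSr.
rewrite /monom rmorph_prod {2}[a]multinomUE_id.
elim/big_rec2: _ => [|i x y _ IH]; first by rewrite mps_monom0.
by rewrite rmorphXn /= taylor_var pw IH mps_monomD.
Qed.

Lemma taylorMmonom n (f : obj C n) a g :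
  taylor (f * monom a) g = if (a <= g)%MM then taylor f (g - a)%MM else 0.
Proof. by rewrite rmorphM /= taylor_monom mps_mul_monom. Qed.

Lemma taylorMvarX n (f : obj C n) i p g :
  taylor (f * var i ^+ p) g = if (U_(i) *+ p <= g)%MM then taylor f (g - U_(i) *+ p)%MM else 0.
Proof. by rewrite -monomMU taylorMmonom. Qed.

Lemma hasse_monom n (a g : 'X_{1..n}) : hasse g (monom a) <> 0 -> (g <= a)%MM.
Proof.
have h1 g' : hasse g' (1 : obj C n) <> 0 -> g' = 0%MM.
  have inj0 : injective (fun i : 'I_0 => widen_ord (leq0n n) i) by case.
  have e1 : (1 : obj C n) = coord (fun i : 'I_0 => widen_ord (leq0n n) i) (1 : obj C 0).
    by rewrite rmorph1.
  have ind := proj1 (coord_image inj0 (1 : obj C n)) (ex_intro _ _ e1).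
  move=> hg; apply/mnmP => j; rewrite mnm0E; apply: hasse_indep hg.
  by apply: ind; apply/codomP => -[[]].
have hv (i : 'I_n) p g' : hasse g' (var i ^+ p : obj C n) <> 0 -> (g' <= U_(i) *+ p)%MM.
  elim: p g' => [|p IH] g'.
    by rewrite expr0 => /h1 ->; apply/mnm_lepP => j; rewrite mnm0E.
  rewrite exprSr => /hasseM_neq0 [g1 [g2 [-> /IH /mnm_lepP l1 l2]]].
  rewrite mulmSr; apply/mnm_lepP => j; rewrite !mnmDE leq_add ?l1 //.
  have [->|ne] := eqVneq g2 0%MM; first by rewrite mnm0E.
  by move: l2; rewrite hasse_var //; case: eqP => [->|].
rewrite /monom [X in (_ <= X)%MM]multinomUE_id.
elim/big_rec2: _ g => [|i x y _ IH] g; first by move/h1 ->; exact: lepm_refl.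
move=> /hasseM_neq0 [g1 [g2 [-> /hv /mnm_lepP l1 /IH /mnm_lepP l2]]].
by apply/mnm_lepP => j; rewrite !mnmDE leq_add.
Qed.

End Basics.

(** * Implicit functions and Weierstrass division *)

Lemma split_lshift m n (i : 'I_m) : fintype.split (lshift n i) = inl i.
Proof. exact: (unsplitK (inl i)). Qed.

Lemma split_rshift m n (j : 'I_n) : fintype.split (rshift m j) = inr j.
Proof. exact: (unsplitK (inr j)). Qed.

Section Weierstrass.
Variables (K : fieldType) (C : smooth_category K).

Lemma coord_hasse_supp k n (s : 'I_k -> 'I_n) (f : obj C k) g j : injective s ->
  j \notin codom s -> hasse g (coord s f) <> 0 -> g j = 0%N.
Proof.
move=> s_inj hj; apply: hasse_indep => p hp.
exact: (proj1 (coord_image s_inj _) (ex_intro _ f erefl)).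
Qed.

Lemma coord_taylor_supp k n (s : 'I_k -> 'I_n) (f : obj C k) g j : injective s ->
  j \notin codom s -> taylor (coord s f) g != 0 -> g j = 0%N.
Proof.
move=> s_inj hj hg; apply: (coord_hasse_supp (f := f)) s_inj hj _.
by apply/eqP; apply: contraNneq hg => e; rewrite -hasse_res e rmorph0.
Qed.

Definition graph l d (y : 'I_d -> obj C l) (i : 'I_(l + d)) : obj C l :=
  match fintype.split i with inl a => var a | inr b => y b end.

Lemma graph_l l d (y : 'I_d -> obj C l) a : graph y (lshift d a) = var a.
Proof. by rewrite /graph split_lshift. Qed.

Lemma graph_r l d (y : 'I_d -> obj C l) b : graph y (rshift l b) = y b.
Proof. by rewrite /graph split_rshift. Qed.

Lemma res_graph l d (y : 'I_d -> obj C l) : (forall i, res (y i) = 0) ->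
  forall i, res (graph y i) = 0.
Proof. by move=> hy i; rewrite /graph; case: split_ordP => j _; rewrite ?res_var ?hy. Qed.

Let res_zero_graph l d i : res (graph (fun=> 0 : obj C l) (i : 'I_(l + d))) = 0.
Proof. by apply: res_graph => j; rewrite rmorph0. Qed.

Lemma restrE l d (f : obj C (l + d)) : restr f = subst (graph (fun=> 0)) f.
Proof. by []. Qed.

Lemma restr_l l d a : restr (var (lshift d a) : obj C (l + d)) = var a.
Proof. by rewrite restrE (substX (@res_zero_graph l d)) graph_l. Qed.

Lemma restr_r l d b : restr (var (rshift l b) : obj C (l + d)) = 0.
Proof. by rewrite restrE (substX (@res_zero_graph l d)) graph_r. Qed.

Lemma restr_res l d (f : obj C (l + d)) : res (restr f : obj C l) = res f.
Proof. by rewrite restrE (subst_res (@res_zero_graph l d)). Qed.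

Lemma restr_coord l d (f : obj C l) : restr (coord (lshift d) f) = f.
Proof.
rewrite restrE (subst_coord (lshift d) (@res_zero_graph l d)) -[RHS]subst_id.
by congr (subst _ _); apply: funext => i; rewrite graph_l.
Qed.

(** The map (x, y) -> (x, r(x, y)) is invertible; the y-part of its inverse,
    restricted to y = 0, parametrizes the zero set of r. *)
Lemma implicit_function l d (r : 'I_d -> obj C (l + d)) :
  (forall i, res (r i) = 0) ->
  \det (\matrix_(i < d, j < d) taylor (r i) U_(rshift l j)%MM) != 0 ->
  exists y : 'I_d -> obj C l,
    (forall i, res (y i) = 0) /\ forall i, subst (graph y) (r i) = 0.
Proof.
move=> hr hdet.
pose u (i : 'I_(l + d)) : obj C (l + d) :=
  match fintype.split i with inl a => var (lshift d a) | inr b => r b end.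
have u_l a : u (lshift d a) = var (lshift d a).
  by rewrite /u split_lshift.
have u_r b : u (rshift l b) = r b by rewrite /u split_rshift.
have res_u i : res (u i) = 0.
  by rewrite /u; case: split_ordP => j _; rewrite ?res_var ?hr.
have hu i : u i \in maxid C _ by apply/maxid_res.
have [|w [hw [k1 _]]] := subst_inverse hu.
  set M := \matrix_(i, j) _.
  rewrite -[taylor _ _]/(res (\det M)) -det_map_mx.
  suff -> : map_mx (@res K C (l + d)) M = block_mx 1%:M 0
      (\matrix_(i < d, j < l) taylor (r i) U_(lshift d j)%MM)
      (\matrix_(i < d, j < d) taylor (r i) U_(rshift l j)%MM).
    by rewrite det_lblock det1 mul1r.
  apply/matrixP => i j; rewrite !mxE hasse_res.
  case: (split_ordP i) => i' ->; rewrite !mxE; case: (split_ordP j) => j' ->;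
    rewrite !mxE ?u_l ?u_r // taylor_var /mps_var eq_mnm1.
    by rewrite (inj_eq (@lshift_inj _ _)) eq_sym.
  by rewrite eq_rlshift.
have res_w i : res (w i) = 0 by apply/maxid_res.
pose y b := restr (w (rshift l b)); exists y; split=> [i|i].
  by rewrite /y restr_res.
have -> g : subst (graph y) g = restr (subst w g).
  rewrite restrE (subst_subst (@res_zero_graph l d)) //; congr (subst _ _); apply: funext => j.
  case: (split_ordP j) => j' ->; last by rewrite graph_r.
  rewrite graph_l -[in RHS](substX res_w) -u_l -(substX res_u) k1; exact/esym/restr_l.
by rewrite -u_r -(substX res_u) k1 restr_r.
Qed.

Section GenericDivision.
Variables (l d : nat).
Let t : obj C (1 + l + d) := var (ord_t l d).
Let t0 : 'I_(1 + l) := lshift l ord0.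
Let T := ord_t l d.
Let Y := @ord_y l d.
Let P : obj C (1 + l + d) := t ^+ d + \sum_(i < d) var (Y i) * t ^+ (d - i.+1).

Let neTY i : (T == Y i) = false. Proof. exact: eq_lrshift. Qed.
Let tx_inj : injective (@ord_tx l d). Proof. exact: lshift_inj. Qed.

Lemma ord_xy_l a : @ord_xy l d (lshift d a) = lshift d (rshift 1 a).
Proof. by rewrite /ord_xy split_lshift. Qed.
Lemma ord_xy_r b : @ord_xy l d (rshift l b) = rshift (1 + l) b.
Proof. by rewrite /ord_xy split_rshift. Qed.

Lemma ord_xy_inj : injective (@ord_xy l d).
Proof.
move=> i j; case: (split_ordP i) => i' ->; case: (split_ordP j) => j' ->;
  rewrite ?ord_xy_l ?ord_xy_r.
- by move/lshift_inj/rshift_inj ->.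
- by move/eqP; rewrite eq_lrshift.
- by move/eqP; rewrite eq_rlshift.
- by move/rshift_inj ->.
Qed.

Lemma ord_xy_t : T \notin codom (@ord_xy l d).
Proof.
apply/codomP => -[i]; case: (split_ordP i) => i' ->; rewrite ?ord_xy_l ?ord_xy_r.
  by move/lshift_inj/eqP; rewrite eq_lrshift.
by move/eqP; rewrite eq_lrshift.
Qed.

Let coefP (h : obj C (1 + l + d)) g : taylor (h * P) g =
  taylor (h * monom C (U_(T) *+ d)%MM) g
  + \sum_(i < d) taylor (h * monom C (U_(Y i) + U_(T) *+ (d - i.+1))%MM) g.
Proof.
rewrite /P mulrDr mulr_sumr taylorD taylor_sum monomMU.
congr (_ + _); apply: eq_bigr => i _; rewrite monomD monomMU.
by have := monomMU C (Y i) 1; rewrite mulm1n expr1 => ->.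
Qed.

Let coefR (f : obj C (l + d)) i s (a : 'X_{1..1 + l + d}) : a T = 0%N ->
  taylor (coord (@ord_xy l d) f * t ^+ i) (a + U_(T) *+ s)%MM =
  if i == s then taylor (coord (@ord_xy l d) f) a else 0.
Proof.
move=> ha; rewrite taylorMvarX; case: eqVneq => [->|ne].
  by rewrite lem_addl addmK.
case: ifP => // le_is; apply: contraNeq ne => /(coord_taylor_supp ord_xy_inj ord_xy_t).
rewrite mnmBE mnmDE ha !mulmnE !mnm1E eqxx !mul1n add0n => /eqP.
rewrite subn_eq0 => h; rewrite eqn_leq h.
move/mnm_lepP: le_is => /(_ T); rewrite mnmDE ha !mulmnE !mnm1E eqxx !mul1n => ->.
by [].
Qed.

(** Comparing coefficients in a generic division D = h P + sum r_i t^i of a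
    series of order d in t shows that h is a unit and that the Jacobian of the
    r_i in y is triangular up to reversing the columns, with diagonal - h(0);
    so y can be chosen as a function of x making all the r_i vanish. *)
Lemma weierstrass_data (D : obj C (1 + l)) (h : obj C (1 + l + d)) r :
  (forall s, (s < d)%N -> taylor D (U_(t0) *+ s)%MM = 0) ->
  taylor D (U_(t0) *+ d)%MM != 0 ->
  coord (@ord_tx l d) D = h * P + \sum_(i < d) coord (@ord_xy l d) (r i) * t ^+ i ->
  res h != 0 /\ exists y : 'I_d -> obj C l,
    (forall i, res (y i) = 0) /\ forall i, subst (graph y) (r i) = 0.
Proof.
move=> hD hDd e.
have E g : taylor (coord (@ord_tx l d) D) g = taylor (h * P) g +
    \sum_(i < d) taylor (coord (@ord_xy l d) (r i) * t ^+ i) g.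
  by rewrite e taylorD taylor_sum.
have EL s : taylor (coord (@ord_tx l d) D) (U_(T) *+ s)%MM = taylor D (U_(t0) *+ s)%MM.
  by rewrite -(coord_taylor tx_inj) mpushMU.
have ER s : (\sum_(i < d) taylor (coord (@ord_xy l d) (r i) * t ^+ i) (U_(T) *+ s)%MM)
    = if insub s is Some i then res (r i) else 0.
  rewrite (eq_bigr (fun i : 'I_d => if i == s :> nat then res (r i) else 0)); last first.
    move=> i _; have := @coefR (r i) i s 0%MM; rewrite mnm0E add0m => -> //.
    by case: ifP => // _; rewrite -resE coord_res.
  case: insubP => [i _ ei|/negP hs].
    rewrite (bigD1 i) //= ei eqxx big1 ?addr0 // => j ne.
    by rewrite -ei (inj_eq val_inj) (negPf ne).
  rewrite big1 // => i _; case: eqP => // ei; case: hs; rewrite -ei; exact: ltn_ord.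
have EP s : taylor (h * P) (U_(T) *+ s)%MM =
    if (d <= s)%N then taylor h (U_(T) *+ (s - d))%MM else 0.
  rewrite coefP [X in _ + X]big1 ?addr0 => [|i _].
    rewrite taylorMmonom; case: (leqP d s) => hs.
      rewrite -{1 2}(subnKC hs); have -> : (U_(T) *+ (d + (s - d)) =
        U_(T) *+ (s - d) + U_(T) *+ d)%MM.
        by apply/mnmP => i; rewrite mnmDE !mulmnE mulnDr [RHS]addnC.
      by rewrite lem_addl addmK.
    case: ifP => // /mnm_lepP /(_ T); rewrite !mulmnE mnm1E eqxx !mul1n.
    by rewrite leqNgt hs.
  rewrite taylorMmonom; case: ifP => // /mnm_lepP /(_ (Y i)).
  by rewrite mnmDE !mulmnE !mnm1E eqxx neTY.
have hr s : res (r s) = 0.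
  have := E (U_(T) *+ s)%MM; rewrite EL hD // EP ER leqNgt ltn_ord add0r.
  case: insubP => [i _ /val_inj ->|]; last by rewrite ltn_ord.
  by move=> <-.
have hh : res h != 0.
  apply: contraNneq hDd => h0; rewrite -EL E EP ER leqnn subnn mulm0n -resE h0 add0r.
  by case: insubP => [i /= _ _|//]; rewrite hr.
split=> //; apply: implicit_function hr _; set M := \matrix_(i, j) _.
have EM (s j : 'I_d) : M s j = - (if (d - j.+1 <= s)%N then
    taylor h (U_(T) *+ (s - (d - j.+1)))%MM else 0).
  pose g := (U_(Y j) + U_(T) *+ s)%MM; have := E g.
  have -> : taylor (coord (@ord_tx l d) D) g = 0.
    apply/eqP; apply: contraT => /(@coord_taylor_supp _ _ _ _ g (Y j) tx_inj).
    rewrite mnmDE mulmnE !mnm1E eqxx neTY => h'; suff /h' : Y j \notin codom (@ord_tx l d) by [].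
    by apply/codomP => -[i] /eqP; rewrite eq_rlshift.
  have -> : \sum_(i < d) taylor (coord (@ord_xy l d) (r i) * t ^+ i) g = M s j.
    rewrite (bigD1 s) //= big1 ?addr0 => [|i ne]; rewrite coefR ?mnm1E 1?eq_sym ?neTY //.
      by rewrite eqxx mxE /Y /ord_y -ord_xy_r -mpush1 ?coord_taylor //; exact: ord_xy_inj.
    by rewrite -val_eqE in ne; rewrite eq_sym (negPf ne).
  suff -> : taylor (h * P) g = (if (d - j.+1 <= s)%N then
    taylor h (U_(T) *+ (s - (d - j.+1)))%MM else 0).
    by move/esym/eqP; rewrite addrC addr_eq0 => /eqP.
  rewrite coefP taylorMmonom; case: ifP => [/mnm_lepP /(_ T)|_].
    rewrite mnmDE !mulmnE !mnm1E eqxx eq_sym neTY !mul1n add0n leqNgt ltn_ord //.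
  rewrite add0r (bigD1 j) //= [X in _ + X]big1 ?addr0 => [|i ne].
    rewrite taylorMmonom; case: (leqP (d - j.+1) s) => hs.
      have -> : g = (U_(T) *+ (s - (d - j.+1)) + (U_(Y j) + U_(T) *+ (d - j.+1)))%MM.
        apply/mnmP => i; rewrite !mnmDE !mulmnE addnCA -mulnDr subnK //.
      by rewrite lem_addl addmK.
    case: ifP => // /mnm_lepP /(_ T).
    by rewrite !mnmDE !mulmnE !mnm1E eqxx eq_sym neTY !mul1n !add0n leqNgt hs.
  rewrite taylorMmonom; case: ifP => // /mnm_lepP /(_ (Y i)).
  rewrite !mnmDE !mulmnE !mnm1E eqxx neTY !mul0n.
  by rewrite (inj_eq (@rshift_inj _ _)) eq_sym (negPf ne).
(* reversing the columns makes the Jacobian lower triangular *)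
pose p := perm (@rev_ord_inj d).
have : \det (col_perm p M) != 0.
  rewrite det_trig.
    apply/prodf_neq0 => i _; rewrite mxE permE EM /= oppr_eq0.
    by rewrite subnSK // subKn ?(ltnW (ltn_ord i)) // leqnn subnn mulm0n.
  apply/is_trig_mxP => i j lt_ij; rewrite mxE permE EM /=.
  by rewrite subnSK // subKn ?(ltnW (ltn_ord j)) // leqNgt lt_ij oppr0.
by apply: contraNneq => e0; rewrite col_permE det_mulmx e0 mul0r.
Qed.

End GenericDivision.

(** Substituting for y the functions found above turns generic division of D
    into D = unit * Weierstrass polynomial, and generic division of g into the
    division of g by that polynomial. *)
Lemma weierstrass_division l d (D : obj C (1 + l)) (t0 := lshift l ord0 : 'I_(1 + l)) :
  (forall s, (s < d)%N -> taylor D (U_(t0) *+ s)%MM = 0) ->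
  taylor D (U_(t0) *+ d)%MM != 0 ->
  forall g, exists (h : obj C (1 + l)) (r : 'I_d -> obj C l),
    g = h * D + \sum_(i < d) coord (@rshift 1 l) (r i) * var t0 ^+ i.
Proof.
move=> hD hDd g.
have [h [r e]] := generic_division d D; have [h' [r' e']] := generic_division d g.
have [hh [y [hy ry]]] := weierstrass_data hD hDd e.
pose z := graph (fun b : 'I_d => coord (@rshift 1 l) (y b)).
have hz : forall i, res (z i) = 0 by apply: res_graph => i; rewrite coord_res hy.
have hgy := res_graph hy.
have z_tx f : subst z (coord (@ord_tx l d) f) = f.
  rewrite subst_coord // -[RHS]subst_id; congr (subst _ _); apply: funext => i.
  by rewrite /z graph_l.
have z_xy f : subst z (coord (@ord_xy l d) f) = coord (@rshift 1 l) (subst (graph y) f).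
  rewrite subst_coord // /coord subst_subst //; last by move=> i; rewrite res_var.
  congr (subst _ _); apply: funext => i; case: (split_ordP i) => j ->.
    by rewrite ord_xy_l /z !graph_l substX // => ?; rewrite res_var.
  by rewrite ord_xy_r /z !graph_r.
have z_t : subst z (var (ord_t l d)) = var t0 by rewrite substX // /z graph_l.
move/(congr1 (subst z)): e; move/(congr1 (subst z)): e'.
rewrite !z_tx !rmorphD !rmorphM /=; set P := subst z (_ + _).
rewrite !rmorph_sum /= => e'.
rewrite [X in _ + X]big1 ?addr0 => [e|i _]; last first.
  by rewrite rmorphM /= z_xy ry rmorph0 mul0r.
have u : subst z h \is a GRing.unit by apply: res_unit; rewrite subst_res.
exists (subst z h' / subst z h), (fun i => subst (graph y) (r' i)).
rewrite e' e mulrA divrK //; congr (_ + _); apply: eq_bigr => i _.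
by rewrite rmorphM rmorphXn /= z_xy z_t.
Qed.

End Weierstrass.

(** * Orders on monomials and leading terms *)

Record monomial_order N (le : rel 'X_{1..N}) : Prop := MonomialOrder {
  mo_trans : transitive le;
  mo_total : total le;
  mo_add : forall c a b, le (a + c)%MM (b + c)%MM = le a b;
  mo_pos : forall a, le a 0%MM -> a = 0%MM;
  mo_wf : forall P : 'X_{1..N} -> Prop, (exists a, P a) ->
    exists2 a, P a & forall b, P b -> le a b
}.

Section Orders.
Variables (N : nat) (le : rel 'X_{1..N}) (mo : monomial_order le).
Local Notation lt a b := (~~ le b a).

Lemma mo_refl a : le a a. Proof. by have := mo_total mo a a; rewrite orbb. Qed.

Lemma mo_ltW a b : lt a b -> le a b.
Proof. by move=> /negPf h; have := mo_total mo a b; rewrite h orbF. Qed.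

Lemma mo_lt_le a b c : lt a b -> le b c -> lt a c.
Proof. by move=> h h'; apply: contra h => h''; exact: mo_trans h' h''. Qed.

Lemma mo_ltDl a b a' b' : lt a b -> le a' b' -> lt (a + a')%MM (b + b')%MM.
Proof.
move=> h h'; apply: (@mo_lt_le _ (b + a')%MM); first by rewrite mo_add.
by rewrite ![(b + _)%MM]addmC mo_add.
Qed.

Lemma mo_ltDr a b a' b' : le a b -> lt a' b' -> lt (a + a')%MM (b + b')%MM.
Proof. by move=> h h'; rewrite [(a + _)%MM]addmC [(b + _)%MM]addmC mo_ltDl. Qed.

Lemma mo_leDl a b : le a (a + b)%MM.
Proof.
rewrite -{1}[a]add0m [(a + b)%MM]addmC (mo_add mo); have [->|] := eqVneq b 0%MM; first exact: mo_refl.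
by move=> ne; apply: mo_ltW; apply: contra ne => /(mo_pos mo) ->.
Qed.

Lemma mo_eq_addl a b : le (a + b)%MM a -> b = 0%MM.
Proof. by rewrite -{2}[a]add0m addmC (mo_add mo) => /(mo_pos mo). Qed.

Lemma mo_mulU (i : 'I_N) s d : le (U_(i) *+ s)%MM (U_(i) *+ d)%MM = (s <= d)%N.
Proof.
have MD m k : (U_(i) *+ (m + k) = U_(i) *+ m + U_(i) *+ k)%MM.
  by apply/mnmP => j; rewrite mnmDE !mulmnE mulnDr.
have [/subnKC <-|lt_ds] := leqP s d; first by rewrite MD mo_leDl.
apply/negP; rewrite -(subnKC (ltnW lt_ds)) MD => /mo_eq_addl /mnmP /(_ i) /eqP.
by rewrite mulmnE mnm1E eqxx mul1n mnm0E subn_eq0 leqNgt lt_ds.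
Qed.

End Orders.

Lemma mulUI N (i : 'I_N) : injective (fun s => U_(i) *+ s)%MM.
Proof. by move=> s s' /mnmP /(_ i); rewrite !mulmnE mnm1E eqxx !mul1n. Qed.

Lemma mulUD N (i : 'I_N) s s' : (U_(i) *+ (s + s') = U_(i) *+ s + U_(i) *+ s')%MM.
Proof. by apply/mnmP => j; rewrite mnmDE !mulmnE mulnDr. Qed.

Lemma mulU_split N (i : 'I_N) s a b : (U_(i) *+ s = a + b)%MM ->
  exists s1 s2, [/\ s = (s1 + s2)%N, a = (U_(i) *+ s1)%MM & b = (U_(i) *+ s2)%MM].
Proof.
move=> /mnmP e; exists (a i), (b i); split.
- by have := e i; rewrite mnmDE mulmnE mnm1E eqxx mul1n.
- apply/mnmP => j; have := e j; rewrite mnmDE !mulmnE mnm1E.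
  by case: eqP => [->|_]; rewrite ?mul1n // !mul0n => /esym/eqP; rewrite addn_eq0 => /andP [/eqP].
- apply/mnmP => j; have := e j; rewrite mnmDE !mulmnE mnm1E.
  by case: eqP => [->|_]; rewrite ?mul1n // !mul0n => /esym/eqP; rewrite addn_eq0 => /andP [_ /eqP].
Qed.

(** * From E(t, x)-modules to E(x)-modules *)

Section Malgrange.
Variables (K : fieldType) (C : smooth_category K).
Variables (N : nat) (le : rel 'X_{1..N}) (mo : monomial_order le).
Local Notation lt a b := (~~ le b a).

(** A row vector over K that the residue matrix maps to 0 must vanish: in the
    column of the lowest index of its support the triangular shape leaves a
    single term.  So the determinant is not in the maximal ideal. *)
Lemma triangular_inverse l (I : finType) (mu : I -> 'X_{1..N}) (rho : I -> I -> obj C l) :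
  (forall i j, res (rho i j) != 0 -> i = j \/ lt (mu i) (mu j)) ->
  (forall i, res (rho i i) != 0) ->
  exists rho' : I -> I -> obj C l,
    forall i k, \sum_j rho' i j * rho j k = (i == k)%:R.
Proof.
move=> htri hdiag.
pose M := \matrix_(i < #|I|, j < #|I|) rho (enum_val i) (enum_val j).
have uM : M \in unitmx.
  rewrite unitmxE; apply: res_unit; rewrite -det_map_mx -unitfE -unitmxE -row_free_unit.
  apply: inj_row_free => v /rowP hv; apply: contrapT => v0.
  have [i0 hi0] : exists i, v 0 i != 0.
    apply/existsP; apply: contra_notT v0 => /existsPn h; apply/rowP => i.
    by move: (h i); rewrite negbK mxE => /eqP.
  have [_ [i hi <-] hmin] := mo_wf mo (ex_intro (fun a => exists2 i, v 0 i != 0 &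
    mu (enum_val i) = a) _ (ex_intro2 _ _ i0 hi0 erefl)).
  have := hv i; rewrite !mxE (bigD1 i) //= big1 => [/eqP|j ne].
    by rewrite addr0 mulf_eq0 (negPf hi) !mxE (negPf (hdiag _)).
  rewrite !mxE; apply/eqP; rewrite mulf_eq0; apply: contraT.
  rewrite negb_or => /andP [hj /htri [/enum_val_inj e|]]; first by rewrite e eqxx in ne.
  by rewrite hmin //; exists j.
exists (fun i j => invmx M (enum_rank i) (enum_rank j)) => i k.
have /matrixP /(_ (enum_rank i) (enum_rank k)) := mulVmx uM.
rewrite !mxE (inj_eq enum_rank_inj) => <-.
rewrite (reindex (@enum_val I I)) /=; last first.
  by exists enum_rank => x _; [exact: enum_valK | exact: enum_rankK].
by apply: eq_bigr => j _; rewrite enum_valK mxE enum_rankK.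
Qed.

Section Lead.
Variables (l : nat) (t : 'I_N) (t0 : 'I_(1 + l)).

(** Think of F(t) as the coefficient of the basis vector u^q in an element whose
    initial monomial is p, with initial coefficient c if it occurs in F(t) u^q. *)
Definition lead (q p : 'X_{1..N}) (c : K) (F : mpseries (1 + l) K) : Prop :=
  forall s, le (q + U_(t) *+ s)%MM p ->
    F (U_(t0) *+ s)%MM = if (q + U_(t) *+ s)%MM == p then c else 0.

Lemma leadM q p c F q' p' c' F' :
  c = 0 \/ (exists s, q + U_(t) *+ s = p)%MM ->
  c' = 0 \/ (exists s, q' + U_(t) *+ s = p')%MM ->
  lead q p c F -> lead q' p' c' F' -> lead (q + q') (p + p') (c * c') (F * F').
Proof.
move=> hc hc' hF hF' s hs.
have split s1 s2 : s = (s1 + s2)%N -> F (U_(t0) *+ s1)%MM != 0 ->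
    F' (U_(t0) *+ s2)%MM != 0 ->
    [/\ (q + U_(t) *+ s1 = p)%MM, (q' + U_(t) *+ s2 = p')%MM, c != 0 & c' != 0].
  move=> es h1 h2; case: (boolP (le (q + U_(t) *+ s1)%MM p)) => le1; last first.
    suff : lt (p + p')%MM (q + q' + U_(t) *+ s)%MM by rewrite hs.
    have -> : (q + q' + U_(t) *+ s = (q + U_(t) *+ s1) + (q' + U_(t) *+ s2))%MM.
      by rewrite es mulUD; apply/mnmP => j; rewrite !mnmDE addnACA.
    apply: (mo_ltDl mo) => //; case: (boolP (le (q' + U_(t) *+ s2)%MM p')) => [le2|/(mo_ltW mo)//].
    by move: h2; rewrite hF' //; have [->|_] := eqVneq _ p'; rewrite ?eqxx // mo_refl.
  move: h1; rewrite hF //; have [e1 c0|_] := eqVneq _ p; last by rewrite eqxx.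
  case: (boolP (le (q' + U_(t) *+ s2)%MM p')) => le2; last first.
    suff : lt (p + p')%MM (q + q' + U_(t) *+ s)%MM by rewrite hs.
    have -> : (q + q' + U_(t) *+ s = (q + U_(t) *+ s1) + (q' + U_(t) *+ s2))%MM.
      by rewrite es mulUD; apply/mnmP => j; rewrite !mnmDE addnACA.
    by rewrite e1; apply: (mo_ltDr mo) => //; exact: mo_refl.
  by move: h2; rewrite hF' //; have [e2 c0'|_] := eqVneq _ p'; last by rewrite eqxx.
have split' : (F * F') (U_(t0) *+ s)%MM != 0 -> exists s1 s2,
    [/\ (q + U_(t) *+ s1 = p)%MM, (q' + U_(t) *+ s2 = p')%MM, c != 0, c' != 0 & s = (s1 + s2)%N].
  move=> /mps_mul_neq0 [a [b [/mulU_split [s1 [s2 [es -> ->]]] h1 h2]]].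
  by have [? ? ? ?] := split _ _ es h1 h2; exists s1, s2.
case: eqP => e; last first.
  apply: contra_notP e => /eqP /split' [s1 [s2 [<- <- _ _ ->]]].
  by rewrite mulUD; apply/mnmP => j; rewrite !mnmDE addnACA.
have [z|nz] := eqVneq (c * c') 0.
  rewrite z; apply/eqP; apply: contraT => /split' [s1 [s2 [_ _ c0 c0' _]]].
  by move/eqP: z; rewrite mulf_eq0 (negPf c0) (negPf c0').
move: (nz); rewrite mulf_eq0 negb_or => /andP [c0 c0'].
case: hc => [z|[s1 e1]]; first by rewrite z eqxx in c0.
case: hc' => [z|[s2 e2]]; first by rewrite z eqxx in c0'.
have es : s = (s1 + s2)%N.
  apply: (@mulUI _ t); apply: (@addmI _ (q + q')%MM); rewrite e -e1 -e2 mulUD.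
  by apply/mnmP => j; rewrite !mnmDE addnACA.
rewrite es mulUD mps_mul_single => [|a' b'].
  by rewrite hF ?hF' ?e1 ?e2 ?eqxx // mo_refl.
rewrite -mulUD => /mulU_split [s1' [s2' [es' -> ->]]] h1 h2.
have [e1' _ _ _] := split _ _ (etrans es es') h1 h2.
by congr (_ *+ _)%MM; apply: (@mulUI _ t); apply: (@addmI _ q); rewrite e1 e1'.
Qed.

Lemma lead1 : lead 0 0 1 1.
Proof.
move=> s; rewrite add0m => /(mo_pos mo) e; rewrite e eqxx.
have -> : s = 0%N by apply: (@mulUI _ t); rewrite e mulm0n.
by rewrite mulm0n /GRing.one /= /mps_one eqxx.
Qed.

Lemma lead_sum (I : Type) (r : seq I) q p (c : I -> K) F :
  (forall i, lead q p (c i) (F i)) -> lead q p (\sum_(i <- r) c i) (\sum_(i <- r) F i).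
Proof.
move=> h s hs; rewrite mps_sumE (eq_bigr _ (fun i _ => h i s hs)).
by case: eqP => // _; rewrite big1.
Qed.

Lemma lead_sign q p c F (b : bool) : lead q p c F -> lead q p ((-1) ^+ b * c) ((-1) ^+ b * F).
Proof.
case: b; rewrite ?expr0 ?mul1r // expr1 !mulN1r => h s /h.
rewrite -[(- F) _]/(- (F _)) => ->; by case: ifP; rewrite ?oppr0.
Qed.

Lemma lead_prod (I : Type) (r : seq I) (q p : I -> 'X_{1..N}) (c : I -> K) F :
  (forall i, lead (q i) (p i) (c i) (F i)) ->
  (forall i, c i = 0 \/ (exists s, q i + U_(t) *+ s = p i)%MM) ->
  lead (\big[+%MM/0%MM]_(i <- r) q i) (\big[+%MM/0%MM]_(i <- r) p i)
    (\prod_(i <- r) c i) (\prod_(i <- r) F i).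
Proof.
move=> h hc.
suff [] : lead (\big[+%MM/0%MM]_(i <- r) q i) (\big[+%MM/0%MM]_(i <- r) p i)
    (\prod_(i <- r) c i) (\prod_(i <- r) F i) /\ ((\prod_(i <- r) c i) = 0 \/
   (exists s, \big[+%MM/0%MM]_(i <- r) q i + U_(t) *+ s = \big[+%MM/0%MM]_(i <- r) p i)%MM) by [].
elim: r => [|i r [IH1 IH2]].
  by rewrite !big_nil; split; [exact: lead1 | right; exists 0%N; rewrite mulm0n addm0].
rewrite !big_cons; split; first exact: leadM.
case: (hc i) => [->|[s1 e1]]; first by left; rewrite mul0r.
case: IH2 => [->|[s2 e2]]; first by left; rewrite mulr0.
right; exists (s1 + s2)%N; rewrite mulUD -e1 -e2.
by apply/mnmP => j; rewrite !mnmDE addnACA.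
Qed.

(** In the Leibniz formula the columns permute the indices q_j, so all products
    have the same total index, and only the diagonal one attains the minimal
    monomial. *)
Lemma lead_det p (q : 'I_p -> 'X_{1..N}) (d : 'I_p -> nat) (c : 'I_p -> K)
    (M : 'M[mpseries (1 + l) K]_p) :
  (forall i j, lead (q j) (q i + U_(t) *+ d i) (if i == j then c i else 0) (M i j)) ->
  let dd := (\sum_i d i)%N in
  (forall s, (s < dd)%N -> (\det M) (U_(t0) *+ s)%MM = 0) /\
  (\det M) (U_(t0) *+ dd)%MM = \prod_i c i.
Proof.
move=> h dd.
have Ed : \big[+%MM/0%MM]_i (q i + U_(t) *+ d i)%MM =
    (\big[+%MM/0%MM]_i q i + U_(t) *+ dd)%MM.
  rewrite big_split /=; congr (_ + _)%MM.
  rewrite /dd; elim/big_rec2: _ => [|i y1 y2 _ ->]; [by rewrite mulm0n | by rewrite mulUD].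
have H : lead (\big[+%MM/0%MM]_i q i) (\big[+%MM/0%MM]_i q i + U_(t) *+ dd)
    (\sum_(s : 'S_p) (-1) ^+ s * \prod_i (if i == s i then c i else 0)) (\det M).
  rewrite /determinant; apply: lead_sum => s; apply: lead_sign.
  rewrite -Ed; have -> : \big[+%MM/0%MM]_i q i = \big[+%MM/0%MM]_i q (s i).
    by rewrite (reindex_inj (@perm_inj _ s)).
  apply: lead_prod => i; first exact: h.
  by case: eqP => [<-|]; [right; exists (d i) | left].
have Ec : \sum_(s : 'S_p) (-1) ^+ s * \prod_i (if i == s i then c i else 0) = \prod_i c i.
  rewrite (bigD1 1%g) //= odd_perm1 expr0 mul1r [X in _ + X]big1 => [|s ne].
    by rewrite addr0; apply: eq_bigr => i _; rewrite perm1 eqxx.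
  have [i hi] : exists i, i != s i.
    apply/existsP; apply: contraNT ne => /existsPn h'; apply/eqP/permP => i.
    by move: (h' i); rewrite negbK perm1 => /eqP <-.
  by rewrite (bigD1 i) //= (negPf hi) mul0r mulr0.
rewrite Ec in H; split=> [s hs|].
  rewrite H ?(inj_eq (@addmI _ _)) ?(inj_eq (@mulUI _ t)) ?ltn_eqF //.
  by rewrite ![(\big[_/_]_i q i + _)%MM]addmC (mo_add mo) (mo_mulU mo) ltnW.
by rewrite H ?eqxx ?mo_refl.
Qed.

End Lead.

Section Step.
Variables (l p : nat) (s : 'I_(1 + l) -> 'I_N).
Let t0 : 'I_(1 + l) := lshift l ord0.
Let t := s t0.
Let emb : obj C l -> obj C N := fun a => coord s (coord (@rshift 1 l) a).

Variables (S T : obj C N -> Prop).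
Hypotheses (S0 : S 0) (SD : forall x y, S x -> S y -> S (x + y))
  (SM : forall a x, S x -> S (coord s a * x)).
Hypotheses (ST : forall x, S x -> T x) (TD : forall x y, T x -> T y -> T (x + y))
  (TM : forall a x, T x -> T (emb a * x)).

Variables (e : 'I_p -> obj C N) (q : 'I_p -> 'X_{1..N}) (d : 'I_p -> nat).
Variables (c : 'I_p -> K) (M : 'M[obj C (1 + l)]_p).
Hypothesis relM : forall i, S (\sum_j coord s (M i j) * e j).
Hypothesis c_neq0 : forall i, c i != 0.
Hypothesis M_lead : forall i j, lead t t0 (q j) (q i + U_(t) *+ d i)
  (if i == j then c i else 0) (taylor (M i j)).
Hypothesis T_low : forall i x, (x < d i)%N -> T (var t ^+ x * e i).

Let S_sum (I : Type) (r : seq I) (P : pred I) F : (forall i, P i -> S (F i)) ->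
  S (\sum_(i <- r | P i) F i).
Proof. by move=> h; elim/big_rec: _ => // i x /h; exact: SD. Qed.

Let T_sum (I : Type) (r : seq I) (P : pred I) F : (forall i, P i -> T (F i)) ->
  T (\sum_(i <- r | P i) F i).
Proof. by move=> h; elim/big_rec: _ => [|i x /h]; [exact: ST | exact: TD]. Qed.

Let SN x : S x -> S (- x).
Proof. by move=> h; have := SM (-1) h; rewrite rmorphN1 mulN1r. Qed.

(** Modulo S the determinant of the relations kills all the e_i, so Weierstrass
    division by it leaves finitely many generators t^x e_i over the smaller
    ring.  Those with x >= d_i are multiples of relations whose remainders form a
    triangular system, which expresses them through those with x < d_i. *)
Lemma malgrange_step a i : T (coord s a * e i).
Proof.
have lM j k : lead t t0 (q k) (q j + U_(t) *+ d j) (if j == k then c j else 0)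
    (map_mx taylor M j k) by rewrite mxE; exact: M_lead.
have [lowD topD] := lead_det lM.
rewrite det_map_mx in lowD topD; set D := \det M in lowD topD.
set dd := (\sum_i d i)%N in lowD topD.
have topD0 : taylor D (U_(t0) *+ dd)%MM != 0 by rewrite topD; exact/prodf_neq0.
have killD b j : S (coord s (b * D) * e j).
  rewrite rmorphM -mulrA; apply: SM.
  have -> : coord s D * e j = \sum_i coord s (\adj M j i) * \sum_k coord s (M i k) * e k.
    under eq_bigr => i' _ do rewrite mulr_sumr.
    rewrite exchange_big /=.
    under eq_bigr => k _ do under eq_bigr => i' _ do rewrite mulrA -rmorphM.
    under eq_bigr => k _ do rewrite -mulr_suml -rmorph_sum.
    have adjE k : \sum_i' \adj M j i' * M i' k = D *+ (j == k).
      by have /matrixP /(_ j k) := mul_adj_mx M; rewrite !mxE.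
    under eq_bigr => k _ do rewrite adjE.
    rewrite (bigD1 j) //= big1 ?addr0 ?eqxx // => k ne.
    by rewrite eq_sym (negPf ne) rmorph0 mul0r.
  by apply: S_sum => i' _; apply: SM.
have /choice [h /choice [r hr]] := weierstrass_division lowD topD0.
have res_r b x : res (r b x) = taylor b (U_(t0) *+ x)%MM.
  have -> : taylor b = taylor (h b * D + \sum_(i < dd) coord (@rshift 1 l) (r b i) * var t0 ^+ i).
    by rewrite -hr.
  rewrite taylorD taylor_sum (_ : taylor (h b * D) _ = 0) ?add0r.
    have t0out : t0 \notin codom (@rshift 1 l).
      by apply/codomP => -[k] /eqP; rewrite eq_lrshift.
    rewrite (bigD1 x) //= big1 ?addr0 => [|k ne].
      by rewrite taylorMvarX lepm_refl -[(_ - _)%MM]/(_) -{1}[(U_(t0) *+ x)%MM]add0m addmK -resE coord_res.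
    rewrite taylorMvarX; case: ifP => // /mnm_lepP /(_ t0).
    rewrite !mulmnE mnm1E eqxx !mul1n => le_kx; apply/eqP; apply: contraT.
    move/(coord_taylor_supp (@rshift_inj 1 l) t0out).
    rewrite mnmBE !mulmnE mnm1E eqxx !mul1n => /eqP; rewrite subn_eq0 => le_xk.
    by case/eqP: ne; apply/val_inj/eqP; rewrite eqn_leq le_kx.
  apply/eqP; rewrite rmorphM; apply: contraT => /mps_mul_neq0 [a1 [a2 [/mulU_split]]].
  move=> [s1 [s2 [es _ ->]]] _; rewrite lowD ?eqxx //.
  by rewrite (leq_ltn_trans _ (ltn_ord x)) // es leq_addl.
pose y (x : 'I_p * 'I_dd) := var t ^+ x.2 * e x.1.
have expand b j : coord s b * e j = coord s (h b * D) * e j + \sum_x emb (r b x) * y (j, x).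
  rewrite {1}[b]hr rmorphD mulrDl rmorph_sum mulr_suml; congr (_ + _).
  by apply: eq_bigr => x _; rewrite rmorphM rmorphXn /= coordX mulrA.
suff Ty x : T (y x).
  by rewrite expand; apply: TD; [apply: ST | apply: T_sum => x _; apply: TM].
(* identity rows for x < d_i complete the relations to a square system *)
pose rho (x x' : 'I_p * 'I_dd) : obj C l := if (x.2 < d x.1)%N then (x == x')%:R else
  r (M x.1 x'.1 * var t0 ^+ (x.2 - d x.1)) x'.2.
have Trho x' : T (\sum_z emb (rho x' z) * y z).
  rewrite /rho; case: ltnP => hx.
    rewrite (bigD1 x') //= eqxx big1 => [|z ne].
      by rewrite addr0; apply: TM; exact: T_low.
    by rewrite eq_sym (negPf ne) /emb !rmorph0 mul0r.
  apply: ST.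
  rewrite -(pair_bigA _ (fun j z => emb (r (M x'.1 j * var t0 ^+ (x'.2 - d x'.1)) z) * y (j, z))) /=.
  rewrite (eq_bigr (fun j => coord s (var t0 ^+ (x'.2 - d x'.1)) * (coord s (M x'.1 j) * e j)
     - coord s (h (M x'.1 j * var t0 ^+ (x'.2 - d x'.1)) * D) * e j)); last first.
    move=> j _; have := expand (M x'.1 j * var t0 ^+ (x'.2 - d x'.1)) j.
    rewrite rmorphM /= => e1; rewrite mulrA [coord s (_ ^+ _) * _]mulrC e1.
    by rewrite addrC addKr.
  rewrite sumrB -mulr_sumr; apply: SD; first by apply: SM; exact: relM.
  by apply: SN; apply: S_sum => j _; exact: killD.
pose mu (x : 'I_p * 'I_dd) := (q x.1 + U_(t) *+ x.2)%MM.
have res_rho (x1 x2 : 'I_p * 'I_dd) : (d x1.1 <= x1.2)%N -> res (rho x1 x2) =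
    if (x1.2 - d x1.1 <= x2.2)%N then taylor (M x1.1 x2.1) (U_(t0) *+ (x2.2 - (x1.2 - d x1.1)))%MM else 0.
  move=> hx; rewrite /rho ltnNge hx /= res_r taylorMvarX.
  have -> : (U_(t0) *+ (x1.2 - d x1.1) <= U_(t0) *+ x2.2)%MM = (x1.2 - d x1.1 <= x2.2)%N.
    apply/mnm_lepP/idP => [/(_ t0)|h' j]; last by rewrite !mulmnE leq_mul2l h' orbT.
    by rewrite !mulmnE mnm1E eqxx !mul1n.
  by case: ifP => // h'; rewrite -{1}(subnK h') mulUD addmK.
have [||rho' hrho'] := @triangular_inverse l _ mu rho.
- move=> x1 x2; case: (ltnP x1.2 (d x1.1)) => hx.
    by rewrite /rho hx; have [->|_] := eqVneq x1 x2; [left | rewrite rmorph0 eqxx].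
  rewrite res_rho //; case: ifP => [h'|]; last by rewrite eqxx.
  set s1 := (_ - _)%N => h1.
  have es1 : (s1 + (x1.2 - d x1.1))%N = x2.2 by rewrite /s1 subnK.
  case: (boolP (le (q x2.1 + U_(t) *+ s1)%MM (q x1.1 + U_(t) *+ d x1.1)%MM)) => [le1|lt1].
    move: h1; rewrite M_lead //.
    have [e1|_] := eqVneq (_ + _)%MM; last by rewrite eqxx.
    have [e2|_] := eqVneq x1.1; last by rewrite eqxx.
    move: e1; rewrite -e2 => /addmI /mulUI e1 _; left.
    by apply: injective_projections => //; apply: val_inj; rewrite /= -es1 e1 subnKC.
  right; rewrite /mu; apply: contra lt1 => h2.
  rewrite -(mo_add mo (U_(t) *+ (x1.2 - d x1.1))%MM) -!addmA -!mulUD.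
  by rewrite es1 subnKC.
- move=> x1; case: (ltnP x1.2 (d x1.1)) => hx.
    by rewrite /rho hx eqxx rmorph1 oner_eq0.
  by rewrite res_rho // leq_subr subKn // M_lead ?eqxx // mo_refl.
have -> : y x = \sum_j emb (rho' x j) * \sum_z emb (rho j z) * y z.
  under eq_bigr => j _ do rewrite mulr_sumr.
  rewrite exchange_big /=.
  under eq_bigr => z _ do under eq_bigr => j _ do rewrite mulrA /emb -!rmorphM.
  under eq_bigr => z _ do rewrite -mulr_suml -!rmorph_sum /= hrho'.
  rewrite (bigD1 x) //= eqxx !rmorph1 mul1r big1 ?addr0 // => z ne.
  by rewrite eq_sym (negPf ne) !rmorph0 mul0r.
by apply: T_sum => j _; apply: TM.
Qed.

End Step.
End Malgrange.

(** * Functions of the last coordinates *)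

Section CoordFrom.
Variables (K : fieldType) (C : smooth_category K) (N : nat).
Implicit Types (h : obj C N) (l : nat).

Lemma coord_from_ord_inj l : injective (fun i : 'I_(N - l) => Ordinal (coord_from_subproof i)).
Proof. by move=> i j /(congr1 val) /= /addnI /val_inj. Qed.

Lemma coord_from_codom l (j : 'I_N) :
  (j \in codom (fun i : 'I_(N - l) => Ordinal (coord_from_subproof i))) = (l <= j)%N.
Proof.
apply/codomP/idP => [[i ->]|hj]; first exact: leq_addr.
have hi : (j - l < N - l)%N by rewrite ltn_sub2r // (leq_ltn_trans hj).
by exists (Ordinal hi); apply: val_inj; rewrite /= subnKC.
Qed.

Lemma coord_fromP l h : coord_from l h <->
  forall j : 'I_N, (j < l)%N -> forall p, (0 < p)%N -> hasse (U_(j) *+ p)%MM h = 0.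
Proof.
rewrite /coord_from (coord_image (@coord_from_ord_inj l)).
by split=> H j hj; apply: H; move: hj; rewrite coord_from_codom -ltnNge.
Qed.

Lemma coord_from_image k (s : 'I_k -> 'I_N) l h : injective s ->
  (forall j, (j \in codom s) = (l <= j)%N) ->
  coord_from l h <-> exists b, h = coord s b.
Proof.
move=> s_inj hs; rewrite coord_fromP (coord_image s_inj).
by split=> H j hj; apply: H; move: hj; rewrite hs -ltnNge.
Qed.

Lemma coord_from_hasse_supp l h g (j : 'I_N) : coord_from l h -> (j < l)%N ->
  hasse g h <> 0 -> g j = 0%N.
Proof. by move=> /coord_fromP H hj; apply: hasse_indep; exact: H. Qed.

Lemma coord_from_supp l h g (j : 'I_N) : coord_from l h -> (j < l)%N ->
  taylor h g != 0 -> g j = 0%N.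
Proof.
move=> H hj hg; apply: (coord_from_hasse_supp H hj) => e.
by rewrite -hasse_res e rmorph0 eqxx in hg.
Qed.

Lemma coord_fromD l h h' : coord_from l h -> coord_from l h' -> coord_from l (h + h').
Proof. by case=> a -> [b ->]; exists (a + b); rewrite rmorphD. Qed.

Lemma coord_fromM l h h' : coord_from l h -> coord_from l h' -> coord_from l (h * h').
Proof. by case=> a -> [b ->]; exists (a * b); rewrite rmorphM. Qed.

Lemma coord_fromN l h : coord_from l h -> coord_from l (- h).
Proof. by case=> a ->; exists (- a); rewrite rmorphN. Qed.

Lemma coord_from0 l : coord_from l (0 : obj C N).
Proof. by exists 0; rewrite rmorph0. Qed.

Lemma coord_from1 l : coord_from l (1 : obj C N).
Proof. by exists 1; rewrite rmorph1. Qed.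

Lemma coord_from_le l l' h : (l' <= l)%N -> coord_from l h -> coord_from l' h.
Proof.
by move=> le_l /coord_fromP H; apply/coord_fromP => j hj; apply: H; exact: leq_trans hj le_l.
Qed.

Lemma coord_from_all h : coord_from 0 h.
Proof. exact/coord_fromP. Qed.

End CoordFrom.

(** * Division by cones *)

Section Cones.
Variables (K : fieldType) (C : smooth_category K) (N : nat).

(** A cone (l, mu, g) stands for the products h g with h depending only on the
    coordinates of index at least l; mu is meant to be the initial monomial of g. *)
Definition cone := (nat * 'X_{1..N} * obj C N)%type.
Definition lev (c : cone) : nat := c.1.1.
Definition vtx (c : cone) : 'X_{1..N} := c.1.2.
Definition gen (c : cone) : obj C N := c.2.

Definition in_cone (c : cone) (g : 'X_{1..N}) : Prop :=
  (vtx c <= g)%MM /\ forall i : 'I_N, (i < lev c)%N -> g i = vtx c i.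

Definition disjoint_cones (L : seq cone) : Prop :=
  forall c c' g, c \in L -> c' \in L -> in_cone c g -> in_cone c' g -> c = c'.

Definition rep (L : seq cone) (g : obj C N) : Prop := exists h : cone -> obj C N,
  (forall c, c \in L -> coord_from (lev c) (h c)) /\ g = \sum_(c <- L) h c * gen c.

Lemma rep0 L : rep L 0.
Proof.
exists (fun=> 0); split=> [c _|]; first exact: coord_from0.
by rewrite big1 // => c _; rewrite mul0r.
Qed.

Lemma repD L g g' : rep L g -> rep L g' -> rep L (g + g').
Proof.
case=> h [hh ->] [h' [hh' ->]]; exists (fun c => h c + h' c); split=> [c hc|].
  exact: coord_fromD (hh c hc) (hh' c hc).
by rewrite -big_split; apply: eq_bigr => c _; rewrite mulrDl.
Qed.

Lemma rep_sum L (I : Type) (r : seq I) (P : pred I) F : (forall i, P i -> rep L (F i)) ->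
  rep L (\sum_(i <- r | P i) F i).
Proof. by move=> H; elim/big_rec: _ => [|i x /H]; [exact: rep0 | exact: repD]. Qed.

Lemma repM L l a g : (forall c, c \in L -> (lev c <= l)%N) -> coord_from l a ->
  rep L g -> rep L (a * g).
Proof.
move=> hL ha [h [hh ->]]; exists (fun c => a * h c); split=> [c hc|].
  by apply: coord_fromM (hh c hc); apply: coord_from_le ha; exact: hL.
by rewrite mulr_sumr; apply: eq_bigr => c _; rewrite mulrA.
Qed.

Lemma rep_term L c a : uniq L -> c \in L -> coord_from (lev c) a -> rep L (a * gen c).
Proof.
move=> uL hc ha; exists (fun c' => if c' == c then a else 0); split=> [c' _|].
  by case: eqP => [->|_]; [| exact: coord_from0].
rewrite (bigD1_seq c) //= eqxx big1 ?addr0 // => c' /negPf ->.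
by rewrite mul0r.
Qed.

Lemma rep_sub L L' g : uniq L' -> {subset L <= L'} -> rep L g -> rep L' g.
Proof.
move=> uL' sL [h [hh ->]]; rewrite big_seq; apply: rep_sum => c hc.
exact: rep_term (sL _ hc) (hh _ hc).
Qed.

Section Control.
Variables (le : rel 'X_{1..N}) (mo : monomial_order le).
Local Notation lt a b := (~~ le b a).

Definition initial (F : mpseries N K) (a : 'X_{1..N}) : Prop :=
  F a != 0 /\ forall b, F b != 0 -> b = a \/ lt a b.

Lemma initial_le F a b : initial F a -> F b != 0 -> le a b.
Proof. by case=> _ H /H [->|/(mo_ltW mo)//]; exact: mo_refl. Qed.

Lemma initial_monom a : initial (mps_monom K a) a.
Proof.
rewrite /initial /mps_monom eqxx oner_eq0; split=> // b.
by have [->|_] := eqVneq b a; [left | rewrite eqxx].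
Qed.

Lemma initialMmonom (g : obj C N) a d : initial (taylor g) a ->
  initial (taylor (monom C d * g)) (d + a).
Proof.
case=> h1 h2; split; first by rewrite mulrC taylorMmonom lem_addr addmC addmK.
move=> b; rewrite mulrC taylorMmonom; case: ifP => [/submK e|]; last by rewrite eqxx.
case/h2 => [e'|h]; first by left; rewrite -e e' addmC.
by right; rewrite -e [(d + a)%MM]addmC (mo_add mo).
Qed.

Variables (L : seq cone) (h : cone -> obj C N).
Hypothesis uL : uniq L.
Hypothesis dL : disjoint_cones L.
Hypothesis iL : forall c, c \in L -> initial (taylor (gen c)) (vtx c).
Hypothesis hh : forall c, c \in L -> coord_from (lev c) (h c).
Let g := \sum_(c <- L) h c * gen c.

Definition below (r : 'X_{1..N}) : Prop :=
  forall c a, c \in L -> taylor (h c) a != 0 -> le r (a + vtx c)%MM.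

Lemma in_coneD c a : c \in L -> taylor (h c) a != 0 -> in_cone c (a + vtx c)%MM.
Proof.
move=> hc ha; split; first exact: lem_addl.
by move=> i hi; rewrite mnmDE (coord_from_supp (hh hc) hi ha).
Qed.

Lemma cone_term r c a b : below r -> c \in L -> r = (a + b)%MM ->
  taylor (h c) a != 0 -> taylor (gen c) b != 0 -> b = vtx c.
Proof.
move=> hr hc e ha hb; have [//|lt_b] := (iL hc).2 _ hb.
have := hr c a hc ha; rewrite e ![(a + _)%MM]addmC (mo_add mo) => le_b.
by rewrite le_b in lt_b.
Qed.

(** At a monomial that precedes all the a + vtx c, only leading terms can
    contribute, and at most one of them does, as the cones are disjoint. *)
Lemma taylor_cone r c a : below r -> c \in L -> r = (a + vtx c)%MM -> in_cone c r ->
  taylor g r = taylor (h c) a * taylor (gen c) (vtx c).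
Proof.
move=> hr hc e hin; rewrite /g taylor_sum (bigD1_seq c) //= big1_seq => [|c' /andP [ne hc']].
  rewrite addr0 rmorphM e mps_mul_single // => a' b' e' ha hb.
  have eb : b' = vtx c by apply: cone_term hr hc _ ha hb; rewrite e.
  by move: e'; rewrite eb => /addIm.
apply/eqP; apply: contraNT ne; rewrite rmorphM => /mps_mul_neq0 [a' [b' [e' ha hb]]].
have eb := cone_term hr hc' e' ha hb; apply/eqP; apply: dL (hin) => //.
by rewrite e' eb; exact: in_coneD.
Qed.

Lemma taylor_cone_neq0 r : below r -> taylor g r != 0 ->
  exists c a, [/\ c \in L, r = (a + vtx c)%MM, in_cone c r & taylor (h c) a != 0].
Proof.
move=> hr; rewrite /g taylor_sum => hg.
have [c hc] : exists2 c, c \in L & taylor (h c * gen c) r != 0.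
  apply: contrapT => H; case/eqP: hg; rewrite big1_seq // => c /andP [_ hc].
  by apply/eqP; apply: contra_notT H => H; exists c.
rewrite rmorphM => /mps_mul_neq0 [a [b [e ha hb]]].
have eb := cone_term hr hc e ha hb; exists c, a; split => //; first by rewrite e eb.
by rewrite e eb; exact: in_coneD.
Qed.

(** The least of the leading monomials a + vtx c cannot cancel, so it occurs in
    the sum. *)
Lemma below_initial r : (forall b, taylor g b != 0 -> le r b) -> below r.
Proof.
move=> H c a hc ha.
pose P b := exists c a, [/\ c \in L, taylor (h c) a != 0 & b = (a + vtx c)%MM].
have [b [c' [a' [hc' ha' eb]]] minb] := mo_wf mo (ex_intro P _ (ex_intro _ c (ex_intro _ a
  (And3 hc ha erefl)))).
apply: (mo_trans mo (y := b)); last by apply: minb; exists c, a.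
apply: H; rewrite (@taylor_cone b c' a') //.
- by rewrite mulf_neq0 // (iL hc').1.
- by move=> c2 a2 hc2 ha2; apply: minb; exists c2, a2.
- by rewrite eb; exact: in_coneD.
Qed.

End Control.

Section Division.
Variables (k : nat) (f : 'I_k -> obj C N) (alpha : 'I_k -> 'X_{1..N}) (n : nat).

Definition in_diagram (b : 'X_{1..N}) : bool := [exists i, (alpha i <= b)%MM].
Definition in_proj (j : nat) (b : 'X_{1..N}) : Prop := exists2 a, in_diagram a & proj j a = b.

Definition ideal_cone (c : cone) : Prop :=
  exists2 i, (alpha i <= vtx c)%MM & gen c = monom C (vtx c - alpha i) * f i.
Definition monom_cone (l : nat) (c : cone) : Prop :=
  [/\ lev c = l, gen c = monom C (vtx c), proj l (vtx c) = vtx c & ~~ in_diagram (vtx c)].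
Definition stair_cone (c : cone) : Prop := exists l,
  [/\ monom_cone l.+1 c, ~ in_proj l.+1 (vtx c) & in_proj l (proj l (vtx c))].

(** The state of the division after j coordinates: the cones that are not final
    have their vertex in N^j, are free in the other coordinates, and their
    vertices lie in the projection of the diagram but not in the diagram. *)
Definition division_at (j : nat) (L : seq cone) : Prop :=
  [/\ uniq L, disjoint_cones L, forall g, rep L g &
  forall c, c \in L -> ((lev c <= j)%N /\ (ideal_cone c \/ stair_cone c)) \/
    (monom_cone j c /\ in_proj j (vtx c))].

Hypothesis le_nN : (n <= N)%N.
Hypothesis alpha_supp : forall i (j : 'I_N), (n <= j)%N -> alpha i j = 0%N.
Hypothesis fin_type : forall (j : 'I_N) a, (j < n)%N -> in_diagram a ->
  exists d, in_diagram (proj j a + U_(j) *+ d)%MM.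
Hypothesis k_gt0 : exists i : 'I_k, True.

Variables (le : rel 'X_{1..N}) (mo : monomial_order le).
Hypothesis f_init : forall i, initial le (taylor (f i)) (alpha i).

Lemma in_diagram_up a b : (a <= b)%MM -> in_diagram a -> in_diagram b.
Proof. by move=> h /existsP [i hi]; apply/existsP; exists i; exact: lepm_trans hi h. Qed.

Lemma projE j a (i : 'I_N) : proj j a i = if (i < j)%N then a i else 0%N.
Proof. by rewrite mnmE. Qed.

Lemma in_diagram_proj a : in_diagram (proj n a) = in_diagram a.
Proof.
apply/idP/idP; last first.
  move=> /existsP [i /mnm_lepP hi]; apply/existsP; exists i; apply/mnm_lepP => j.
  by rewrite projE; case: ltnP => // hj; rewrite alpha_supp.
by apply: in_diagram_up; apply/mnm_lepP => j; rewrite projE; case: ifP.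
Qed.

Lemma ideal_cone_init c : ideal_cone c -> initial le (taylor (gen c)) (vtx c).
Proof. by case=> i le_i ->; rewrite -{2}(submK le_i); exact: initialMmonom. Qed.

Lemma monom_cone_init l c : monom_cone l c -> initial le (taylor (gen c)) (vtx c).
Proof. by case=> _ -> _ _; rewrite taylor_monom; exact: initial_monom. Qed.

Lemma division_init j L : division_at j L -> forall c, c \in L ->
  initial le (taylor (gen c)) (vtx c).
Proof.
case=> _ _ _ H c /H [[_ [/ideal_cone_init//|[l [/monom_cone_init//]]]]|[/monom_cone_init//]].
Qed.

(** If 0 lies in the diagram then some f_i is a unit, and its cone is everything. *)
Lemma division_start : exists L, division_at 0 L.
Proof.
have [/existsP [i hi]|hD] := boolP (in_diagram 0%MM).
  have a0 : alpha i = 0%MM.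
    by apply/mnmP => j; move/mnm_lepP: hi => /(_ j); rewrite mnm0E leqn0 => /eqP.
  have u : f i \is a GRing.unit by apply: res_unit; rewrite resE -a0; exact: (f_init i).1.
  exists [:: (0%N, 0%MM, f i)]; split=> //.
  - by move=> c c' g; rewrite !inE => /eqP -> /eqP ->.
  - move=> g; exists (fun=> g / f i); split=> [c|]; last by rewrite big_seq1 /gen /= divrK.
    by rewrite inE => /eqP ->; exact: coord_from_all.
  - move=> c; rewrite inE => /eqP ->; left; split=> //; left; exists i => //.
    by rewrite /vtx /gen /= a0 subm0 monom0 mul1r.
exists [:: (0%N, 0%MM, 1)]; split=> //.
- by move=> c c' g; rewrite !inE => /eqP -> /eqP ->.
- move=> g; exists (fun=> g); split=> [c|]; last by rewrite big_seq1 /gen /= mulr1.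
  by rewrite inE => /eqP ->; exact: coord_from_all.
- move=> c; rewrite inE => /eqP ->; right; split.
    by split; rewrite /lev /vtx /gen /= ?monom0.
  have [i _] := k_gt0; exists (alpha i); first by apply/existsP; exists i; exact: lepm_refl.
  by rewrite -[vtx _]/0%MM; apply/mnmP => j; rewrite projE.
Qed.

Section Step.
Variables (j : nat) (L : seq cone).
Hypotheses (lt_jn : (j < n)%N) (HL : division_at j L).
Let lt_jN : (j < N)%N := leq_trans lt_jn le_nN.
Let t : 'I_N := Ordinal lt_jN.
Let l := (N - j).-1.

Let eNj : (1 + l = N - j)%N.
Proof. by rewrite /l add1n prednK // subn_gt0. Qed.

Let s_proof (i : 'I_(1 + l)) : (j + i < N)%N.
Proof. by rewrite -ltn_subRL -eNj. Qed.
Let s (i : 'I_(1 + l)) : 'I_N := Ordinal (s_proof i).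
Let t0 : 'I_(1 + l) := lshift l ord0.

Let s_inj : injective s.
Proof. by move=> a b /(congr1 val) /= /addnI /val_inj. Qed.

Let st0 : s t0 = t.
Proof. by apply: val_inj; rewrite /= addn0. Qed.

Let from_j (h : obj C N) : coord_from j h <-> exists b, h = coord s b.
Proof.
apply: coord_from_image s_inj _ => i; apply/codomP/idP => [[a ->]|hi]; first exact: leq_addr.
have ha : (i - j < 1 + l)%N by rewrite eNj ltn_sub2r // (leq_ltn_trans hi).
by exists (Ordinal ha); apply: val_inj; rewrite /= subnKC.
Qed.

Let from_j1 (h : obj C N) : coord_from j.+1 h <-> exists b, h = coord s (coord (@rshift 1 l) b).
Proof.
have E (b : obj C l) : coord s (coord (@rshift 1 l) b) = coord (s \o @rshift 1 l) b.
  exact: (@subst_coord _ _ _ _ _ _ (fun i => var (s i)) (fun i => res_var _ _)).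
have inj' : injective (s \o @rshift 1 l) by apply: inj_comp s_inj _; exact: rshift_inj.
rewrite (coord_from_image h inj' (l := j.+1)); first by split=> -[b ->]; exists b; rewrite E.
move=> i; apply/codomP/idP => [[a ->]|hi]; first by rewrite /= addnS leq_addr.
have ha : (i - j.+1 < l)%N.
  by rewrite -ltnS -[l.+1]add1n eNj subnS prednK ?subn_gt0 // ltn_sub2r.
by exists (Ordinal ha); apply: val_inj; rewrite /= add1n addnS -addSn subnKC.
Qed.

(** A free cone with vertex beta is cut at the least d such that
    beta + d e_j lies in the diagram: the part beyond becomes the cone of a
    multiple of some f_i, and each slice below is final or free according to
    whether its vertex leaves the projection of the diagram. *)
Lemma division_step : exists L', division_at j.+1 L'.
Proof.
case: (HL) => uL dL repL cL.
pose isB c := `[< monom_cone j c /\ in_proj j (vtx c) >].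
pose LB := [seq c <- L | isB c]; pose F := [seq c <- L | ~~ isB c].
have LBP c : c \in LB -> [/\ c \in L, monom_cone j c & in_proj j (vtx c)].
  by rewrite mem_filter => /andP [/asboolP [h1 h2] h3].
have FP c : c \in F -> [/\ c \in L, (lev c <= j)%N & ideal_cone c \/ stair_cone c].
  by rewrite mem_filter => /andP [/asboolP h1 h3]; case: (cL c h3) => [[]|].
have vt c : c \in LB -> vtx c t = 0%N.
  by case/LBP => _ [_ _ e _] _; rewrite -e projE ltnn.
have /choice [ii hii] : forall c, exists di : nat * 'I_k, c \in LB ->
    (alpha di.2 <= vtx c + U_(t) *+ di.1)%MM /\
    forall x, (x < di.1)%N -> ~~ in_diagram (vtx c + U_(t) *+ x)%MM.
  move=> c; have [hc|] := boolP (c \in LB); last first.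
    by have [i0 _] := k_gt0; exists (0%N, i0).
  have [_ _ [a ha ea]] := LBP c hc.
  have ex : exists d, in_diagram (vtx c + U_(t) *+ d)%MM by rewrite -ea; exact: (@fin_type t a lt_jn ha).
  case: (ex_minnP ex) => d /existsP [i hi] mind; exists (d, i) => _; split=> // x.
  by apply: contraTN => /mind; rewrite -leqNgt.
pose dd c := (ii c).1.
pose jv c := (vtx c + U_(t) *+ dd c)%MM.
pose Jc c : cone := (j, jv c, monom C (jv c - alpha (ii c).2) * f (ii c).2).
pose Nc b : cone := (j.+1, b, monom C b).
pose news := [seq Nc (vtx c + U_(t) *+ x)%MM | c <- LB, x <- iota 0 (dd c)].
pose LS := undup (F ++ map Jc LB); pose L' := undup (F ++ map Jc LB ++ news).
have L'P c : c \in L' -> c \in F \/ exists2 c0, c0 \in LB &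
    c = Jc c0 \/ exists2 x, (x < dd c0)%N & c = Nc (vtx c0 + U_(t) *+ x)%MM.
  rewrite mem_undup !mem_cat => /or3P [|/mapP [c0 h0 ->]|/allpairsPdep [c0 [x [h0 hx ->]]]].
  - by left.
  - by right; exists c0 => //; left.
  - by right; exists c0 => //; right; exists x => //; rewrite mem_iota in hx.
have LSL' : {subset LS <= L'}.
  by move=> c; rewrite !mem_undup catA => hc; rewrite mem_cat hc.
have newsL' c x : c \in LB -> (x < dd c)%N -> Nc (vtx c + U_(t) *+ x)%MM \in L'.
  move=> hc hx; rewrite mem_undup !mem_cat; apply/or3P/Or33.
  by apply/allpairsPdep; exists c, x; rewrite mem_iota.
have Jideal c : c \in LB -> ideal_cone (Jc c).
  by move=> hc; exists (ii c).2 => //; exact: (hii c hc).1.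
(* reduces disjointness to the pieces of a single old cone *)
have parent c0 c g : c0 \in LB ->
    c = Jc c0 \/ (exists2 x, (x < dd c0)%N & c = Nc (vtx c0 + U_(t) *+ x)%MM) ->
    in_cone c g -> in_cone c0 g.
  move=> h0 hc; have [_ [lev0 _ _ _] _] := LBP _ h0.
  have vE x (i : 'I_N) : (i < j)%N -> (vtx c0 + U_(t) *+ x)%MM i = vtx c0 i.
    move=> hi; rewrite mnmDE mulmnE mnm1E; case: eqP => [e|_]; last by rewrite addn0.
    by move: hi; rewrite -e ltnn.
  case: hc => [->|[x _ ->]] [h1 h2]; (split; first by apply: lepm_trans h1; exact: lem_addr).
    by move=> i; rewrite lev0 => hi; rewrite h2 // vE.
  by move=> i; rewrite lev0 => hi; rewrite h2 ?vE // /lev /= ltnS ltnW.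
have uL' : uniq L' by exact: undup_uniq.
have dL' : disjoint_cones L'.
  have FB c c0 : c \in F -> c0 \in LB -> c <> c0.
    rewrite !mem_filter => /andP [/negP h _] /andP [h' _] e; apply: h; by rewrite e.
  move=> c c' g /L'P [hF|[c0 h0 e0]] /L'P [hF'|[c0' h0' e0']] hc hc'.
  - by apply: dL hc hc'; [case: (FP _ hF) | case: (FP _ hF')].
  - have := parent _ _ _ h0' e0' hc'; move=> hc0; case: (FB _ _ hF h0').
    by apply: dL hc hc0; [case: (FP _ hF) | case: (LBP _ h0')].
  - have := parent _ _ _ h0 e0 hc; move=> hc0; case: (FB _ _ hF' h0).
    by apply: dL hc' hc0; [case: (FP _ hF') | case: (LBP _ h0)].
  have := parent _ _ _ h0 e0 hc; have := parent _ _ _ h0' e0' hc' => p' p0.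
  have e : c0 = c0' by apply: dL p0 p'; [case: (LBP _ h0) | case: (LBP _ h0')].
  rewrite -{}e {c0' h0' p'} in e0' *.
  have Jt : in_cone (Jc c0) g -> (dd c0 <= g t)%N.
    by case=> /mnm_lepP /(_ t); rewrite /vtx /= mnmDE mulmnE mnm1E eqxx mul1n vt.
  have Nt x : in_cone (Nc (vtx c0 + U_(t) *+ x)%MM) g -> g t = x.
    by case=> _ -> //; rewrite /vtx /= mnmDE mulmnE mnm1E eqxx mul1n vt.
  case: e0 e0' hc hc' => [->|[x hx ->]] [->|[x' hx' ->]] //.
  - by move/Jt => h /Nt e; move: hx'; rewrite -e ltnNge h.
  - by move/Nt => e /Jt h; move: hx; rewrite -e ltnNge h.
  - by move/Nt => <- /Nt <-.
have lev_LS c : c \in LS -> (lev c <= j)%N.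
  by rewrite mem_undup mem_cat => /orP [/FP [] //|/mapP [c0 _ ->]].
have lev_L' c : c \in L' -> (lev c <= j.+1)%N.
  by case/L'P => [/FP [_ h _]|[c0 _ [->|[x _ ->]]]] //; exact: leqW.
have initL := division_init HL.
pose p := size LB; pose cc (i : 'I_p) := tnth (in_tuple LB) i.
have ccB i : cc i \in LB by exact: mem_tnth.
have ccL i : cc i \in L by case: (LBP _ (ccB i)).
have uLB : uniq LB by exact: filter_uniq.
have cc_inj : injective cc.
  by move=> i i' /eqP; rewrite /cc !(tnth_nth (cc i)) nth_uniq // => /eqP /val_inj.
have cc_gen i : gen (cc i) = monom C (vtx (cc i)) by case: (LBP _ (ccB i)) => _ [].
have cc_lev i : lev (cc i) = j by case: (LBP _ (ccB i)) => _ [].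
(* dividing u^(..) f_i by the current cones gives a relation between the
   generators of the cones that are not final *)
have /choice [M hM] : forall i, exists m : 'I_p -> obj C (1 + l),
    rep LS (\sum_i' coord s (m i') * gen (cc i')) /\
    forall i', lead le (s t0) t0 (vtx (cc i')) (vtx (cc i) + U_(s t0) *+ dd (cc i))
      (if i == i' then taylor (gen (Jc (cc i))) (jv (cc i)) else 0) (taylor (m i')).
  move=> i; have [h [hh eg]] := repL (gen (Jc (cc i))).
  have initJ := ideal_cone_init (Jideal _ (ccB i)).
  have /choice [m hm] : forall i', exists b, h (cc i') = coord s b.
    by move=> i'; apply/from_j; rewrite -(cc_lev i'); exact: hh.
  exists m; split.
    have -> : \sum_i' coord s (m i') * gen (cc i') =
        1 * gen (Jc (cc i)) + \sum_(c <- F) - h c * gen c.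
      rewrite mul1r eg (bigID isB) /= -[X in _ = X + _ + _]big_filter -/LB.
      rewrite -[X in _ = _ + X + _]big_filter -/F -addrA -big_split /= [X in _ = _ + X]big1 ?addr0.
        rewrite [RHS](big_nth (cc i)) big_mkord; apply: eq_bigr => i' _.
        by rewrite -hm /cc (tnth_nth (cc i)).
      by move=> c _; rewrite mulNr addrN.
    apply: repD; first apply: rep_term; rewrite ?undup_uniq //.
    - by rewrite mem_undup mem_cat map_f ?orbT.
    - exact: coord_from1.
    rewrite big_seq; apply: rep_sum => c hc; apply: rep_term; rewrite ?undup_uniq //.
      by rewrite mem_undup mem_cat hc.
    by apply: coord_fromN; apply: hh; case: (FP _ hc).
  move=> i' x; rewrite st0 => le_x.
  have be : below le L h (jv (cc i)).
    apply: (below_initial mo uL dL initL hh) => b; rewrite -eg; exact: initial_le initJ.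
  set r := (vtx (cc i') + U_(t) *+ x)%MM in le_x *.
  have be' : below le L h r by move=> c a hc ha; exact: mo_trans le_x (be c a hc ha).
  have in_r : in_cone (cc i') r.
    split=> [|i0]; first exact: lem_addr.
    rewrite cc_lev mnmDE mulmnE mnm1E => hi0.
    by case: eqP hi0 => [<-|_]; rewrite ?ltnn // mul0n addn0.
  have mE : taylor (m i') (U_(t0) *+ x)%MM = taylor (h (cc i')) (U_(t) *+ x)%MM.
    by rewrite hm -st0 -(mpushMU s_inj) coord_taylor.
  have gE : taylor (gen (Jc (cc i))) r = taylor (m i') (U_(t0) *+ x)%MM.
    rewrite eg (taylor_cone mo uL dL initL hh be' (ccL i') (a := U_(t) *+ x)%MM) //; last first.
      by rewrite /r addmC.
    by rewrite mE cc_gen taylor_monom /mps_monom eqxx mulr1.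
  have [er|ner] := eqVneq; last first.
    rewrite -gE; apply/eqP; apply: contraT => /(initJ.2) [e|].
      by rewrite e eqxx in ner.
    by rewrite le_x.
  rewrite -gE er; case: eqVneq => // ne; case/eqP: ne; apply: cc_inj.
  have ev : vtx (cc i) = vtx (cc i').
    apply/mnmP => i0; move/mnmP: er => /(_ i0); rewrite !mnmDE !mulmnE mnm1E.
    by case: eqP => [<-|_]; rewrite ?vt // !mul0n !addn0.
  have self c : in_cone c (vtx c) by split=> //; exact: lepm_refl.
  by apply: dL (self _) _ => //; rewrite ev; exact: self.
have S_mul a x : rep LS x -> rep LS (coord s a * x).
  by apply: repM lev_LS _; apply/from_j; exists a.
have T_mul a x : rep L' x -> rep L' (coord s (coord (@rshift 1 l) a) * x).
  by apply: repM lev_L' _; apply/from_j1; exists a.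
have ST x : rep LS x -> rep L' x by exact: rep_sub.
have T_B (i : 'I_p) h : coord_from j h -> rep L' (h * gen (cc i)).
  move=> /from_j [b ->].
  apply: (malgrange_step (s := s) mo (rep0 LS) (@repD LS) S_mul ST (@repD L') T_mul
    (M := \matrix_(i, i') M i i') (e := fun i => gen (cc i)) (q := fun i => vtx (cc i))
    (d := fun i => dd (cc i)) (c := fun i => taylor (gen (Jc (cc i))) (jv (cc i)))).
  - by move=> i'; under eq_bigr => i2 _ do rewrite mxE; exact: (hM i').1.
  - by move=> i'; exact: (ideal_cone_init (Jideal _ (ccB i'))).1.
  - by move=> i' i2; rewrite mxE; exact: (hM i').2.
  - move=> i' x hx; rewrite st0 cc_gen -monomMU -monomD addmC.
    have := rep_term uL' (newsL' _ _ (ccB i') hx) (coord_from1 C N _); by rewrite mul1r.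
exists L'; split=> // [g|c /L'P [/FP [_ h1 h2]|[c0 h0 [->|[x hx ->]]]]].
- have [h [hh ->]] := repL g; rewrite big_seq; apply: rep_sum => c hc.
  have [hB|hF] := boolP (isB c); last first.
    apply: rep_term => //; last exact: hh.
    by apply: LSL'; rewrite mem_undup mem_cat mem_filter hF hc.
  have hcB : c \in LB by rewrite mem_filter hB.
  have hi : (index c LB < p)%N by rewrite index_mem.
  have ec : cc (Ordinal hi) = c by rewrite /cc (tnth_nth c) nth_index.
  by rewrite -ec; apply: T_B; rewrite -(cc_lev (Ordinal hi)) ec; exact: hh.
- by left; split=> //; exact: leqW.
- by left; split=> //; left; exact: Jideal.
have [_ [_ _ e0 _] [a ha ea]] := LBP _ h0.
have projx : proj j.+1 (vtx c0 + U_(t) *+ x)%MM = (vtx c0 + U_(t) *+ x)%MM.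
  apply/mnmP => i; rewrite projE; case: ltnP => // hi.
  rewrite mnmDE mulmnE mnm1E -e0 projE ltnNge (ltnW hi) /=.
  by case: eqP hi => [<-|]; rewrite ?ltnn.
have restx : monom_cone j.+1 (Nc (vtx c0 + U_(t) *+ x)%MM).
  by split=> //; exact: (hii _ h0).2.
have [hp|hp] := pselect (in_proj j.+1 (vtx c0 + U_(t) *+ x)%MM); first by right.
left; split=> //; right; exists j; split=> //; exists a => //.
rewrite ea; apply/mnmP => i; rewrite projE mnmDE mulmnE mnm1E; case: ltnP => hi.
  by case: eqP hi => [<-|]; rewrite ?ltnn // addn0.
by rewrite -e0 projE ltnNge hi.
Qed.

End Step.

(** After n coordinates no free cone is left: the diagram is the preimage of its
    projection to N^n, so a vertex in this projection lies in the diagram. *)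
Lemma division : exists L, [/\ uniq L, disjoint_cones L, forall g, rep L g &
  forall c, c \in L -> (lev c <= n)%N /\ (ideal_cone c \/ stair_cone c)].
Proof.
have step j : (j <= n)%N -> exists L, division_at j L.
  elim: j => [|j IH] lt_jn; first exact: division_start.
  by have [L HL] := IH (ltnW lt_jn); exact: division_step HL.
have [L [uL dL repL cL]] := step n (leqnn n); exists L; split=> // c hc.
case: (cL c hc) => // -[[_ _ _ /negP h] [a ha e]]; case: h.
by rewrite -e in_diagram_proj.
Qed.

Lemma projI j a b : proj j a = proj j b <-> forall i : 'I_N, (i < j)%N -> a i = b i.
Proof.
split=> [/mnmP H i hi|H]; first by have := H i; rewrite !projE hi.
by apply/mnmP => i; rewrite !projE; case: ifP => // /H.
Qed.

(** A cone on a stair stays outside the diagram because the projection of the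
    cone to the coordinates below its level is a single point outside the
    projection of the diagram. *)
Lemma stair_notin_diagram c b : stair_cone c -> in_cone c b -> ~~ in_diagram b.
Proof.
move=> [l [[el _ ep _] hN _]] [_ hb]; apply/negP => db; apply: hN; exists b => //.
by rewrite -ep; apply/projI => i hi; apply: hb; rewrite el.
Qed.

Section Remainder.
Variables (L : seq cone).
Hypotheses (uL : uniq L) (dL : disjoint_cones L).
Hypothesis cL : forall c, c \in L -> (lev c <= n)%N /\ (ideal_cone c \/ stair_cone c).

Let in_self c : in_cone c (vtx c). Proof. by split=> //; exact: lepm_refl. Qed.

Lemma in_diagram_ideal c : c \in L -> in_diagram (vtx c) -> ideal_cone c.
Proof. by move=> /cL [_ [//|/stair_notin_diagram /(_ (in_self c)) /negP]]. Qed.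

Lemma notin_diagram_stair c : c \in L -> ~~ in_diagram (vtx c) -> stair_cone c.
Proof.
by move=> /cL [_ [[i hi _] /negP h|//]]; case: h; apply/existsP; exists i.
Qed.

Lemma cone_init c : c \in L -> initial le (taylor (gen c)) (vtx c).
Proof. by move=> /cL [_ [/ideal_cone_init|[l [/monom_cone_init]]]]. Qed.

Variables (a : 'X_{1..N}) (h : cone -> obj C N).
Hypothesis hh : forall c, c \in L -> coord_from (lev c) (h c).
Hypothesis eh : monom C a = \sum_(c <- L) h c * gen c.

Lemma below_monom : below le L h a.
Proof.
apply: (below_initial mo uL dL cone_init hh) => b; rewrite -eh taylor_monom.
exact: initial_le (initial_monom le a).
Qed.

(** A leading monomial that does not exceed u^a survives in the sum, which is
    u^a. *)
Lemma below_monom_eq c b r : le r a -> c \in L -> taylor (h c) b != 0 ->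
  r = (b + vtx c)%MM -> r = a.
Proof.
move=> le_r hc hb e.
have be : below le L h r by move=> c' b' hc' hb'; exact: (mo_trans mo) le_r (below_monom hc' hb').
have in_r : in_cone c r by rewrite e; exact: (in_coneD hh).
have := taylor_cone mo uL dL cone_init hh be hc e in_r.
rewrite -eh taylor_monom /mps_monom; case: eqP => // _ /esym/eqP.
by rewrite mulf_eq0 (negPf hb) (negPf (cone_init hc).1).
Qed.

Lemma remainder_below b : taylor (\sum_(c <- L | ~~ in_diagram (vtx c)) h c * gen c) b != 0 ->
  le a b /\ ~~ in_diagram b.
Proof.
rewrite taylor_sum => hb.
have [c [hc dc]] : exists c, [/\ c \in L, ~~ in_diagram (vtx c) & taylor (h c * gen c) b != 0].
  apply: contrapT => H; case/eqP: hb; rewrite big1_seq // => c /andP [dc hc].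
  by apply/eqP; apply: contra_notT H => H; exists c.
have st := notin_diagram_stair hc dc; have [l [[_ eg _ _] _ _]] := st.
rewrite eg taylorMmonom; case: ifP => [/submK eb hb'|]; last by rewrite eqxx.
by rewrite -eb; split; [exact: below_monom | apply: stair_notin_diagram st _; exact: (in_coneD hh)].
Qed.

Lemma normal_form_initial : in_diagram a ->
  initial le (taylor (\sum_(c <- L | in_diagram (vtx c)) h c * gen c)) a.
Proof.
move=> da; split.
  have -> : \sum_(c <- L | in_diagram (vtx c)) h c * gen c =
      monom C a - \sum_(c <- L | ~~ in_diagram (vtx c)) h c * gen c.
    by rewrite eh [X in X - _](bigID (fun c => in_diagram (vtx c))) /= addrK.
  rewrite raddfB -[X in X != 0]/(taylor (monom C a) a - taylor _ a) taylor_monom /mps_monom eqxx.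
  set x := taylor _ _; have [->|/remainder_below []] := eqVneq x 0; last by rewrite da.
  by rewrite subr0 oner_eq0.
move=> b; rewrite taylor_sum => hb.
have [c [hc dc]] : exists c, [/\ c \in L, in_diagram (vtx c) & taylor (h c * gen c) b != 0].
  apply: contrapT => H; case/eqP: hb; rewrite big1_seq // => c /andP [dc hc].
  by apply/eqP; apply: contra_notT H => H; exists c.
rewrite rmorphM => /mps_mul_neq0 [b1 [b2 [eb h1 h2]]].
have [le_ba|] := boolP (le b a); last by right.
have [e2|lt2] := (cone_init hc).2 _ h2; last first.
  have := mo_trans mo le_ba (below_monom hc h1).
  by rewrite eb ![(b1 + _)%MM]addmC (mo_add mo) (negPf lt2).
by left; apply: below_monom_eq le_ba hc h1 _; rewrite eb e2.
Qed.

End Remainder.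

(** If the coefficient of f_j in the i-th normal form does not vanish at 0, then
    u^(alpha_j) is a leading monomial in the division of u^(alpha_i), so it does
    not precede u^(alpha_i) and equals it only for j = i; and that leading
    monomial does occur.  Hence the matrix of these coefficients is triangular
    modulo the maximal ideal, and invertible. *)
Lemma normal_forms_generate (L : seq cone) (h : 'I_k -> cone -> obj C N) :
  uniq L -> disjoint_cones L ->
  (forall c, c \in L -> (lev c <= n)%N /\ (ideal_cone c \/ stair_cone c)) ->
  (forall i c, c \in L -> coord_from (lev c) (h i c)) ->
  (forall i, monom C (alpha i) = \sum_(c <- L) h i c * gen c) ->
  (forall i j, (alpha j <= alpha i)%MM -> j = i) ->
  forall g, ideal_gen (fun i => \sum_(c <- L | in_diagram (vtx c)) h i c * gen c) g <-> ideal_gen f g.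
Proof.
move=> uL dL cL hh eh anti.
have /choice [ix hix] : forall c, exists i : 'I_k, c \in L -> in_diagram (vtx c) ->
    (alpha i <= vtx c)%MM /\ gen c = monom C (vtx c - alpha i) * f i.
  move=> c; have [hc|_] := boolP (c \in L); last by have [i0 _] := k_gt0; exists i0.
  have [dc|_] := boolP (in_diagram (vtx c)); last by have [i0 _] := k_gt0; exists i0.
  by have [i hi e] := in_diagram_ideal cL hc dc; exists i.
pose LJ := [seq c <- L | in_diagram (vtx c)].
have LJP c : c \in LJ -> [/\ c \in L, in_diagram (vtx c), (alpha (ix c) <= vtx c)%MM &
    gen c = monom C (vtx c - alpha (ix c)) * f (ix c)].
  by rewrite mem_filter => /andP [dc hc]; have [] := hix c hc dc.
pose H i j := \sum_(c <- LJ | ix c == j) h i c * monom C (vtx c - alpha j).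
have fE i : \sum_(c <- L | in_diagram (vtx c)) h i c * gen c = \sum_j H i j * f j.
  rewrite -big_filter -/LJ (partition_big ix xpredT) //=; apply: eq_bigr => j _.
  rewrite mulr_suml big_seq_cond [RHS]big_seq_cond; apply: eq_bigr => c /andP [hc /eqP <-].
  by have [_ _ _ ->] := LJP c hc; rewrite mulrA.
have res_monom b : res (monom C b) = (b == 0%MM)%:R.
  by rewrite resE taylor_monom /mps_monom eq_sym.
have term i j c : c \in LJ -> ix c = j -> res (h i c * monom C (vtx c - alpha j)) != 0 ->
    res (h i c) != 0 /\ vtx c = alpha j.
  move=> hc e; rewrite rmorphM /= res_monom.
  have [e0|_] := eqVneq (_ - _)%MM 0%MM; last by rewrite mulr0 eqxx.
  rewrite mulr1 => ->; split=> //.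
  by have [_ _ le_c _] := LJP c hc; rewrite -(submK le_c) e e0 add0m.
have [||H' hH'] := @triangular_inverse _ C _ le mo N 'I_k alpha H.
- move=> i j; rewrite /H rmorph_sum => hs.
  have [c [hc ec]] : exists c, [/\ c \in LJ, ix c = j &
      res (h i c * monom C (vtx c - alpha j)) != 0].
    apply: contrapT => H0; case/eqP: hs; rewrite big1_seq // => c /andP [/eqP ec hc].
    by apply/eqP; apply: contra_notT H0 => H0; exists c.
  move/(term i j c hc ec) => [h0 ev]; have [hcL _ _ _] := LJP c hc.
  have [le_ji|] := boolP (le (alpha j) (alpha i)); last by right.
  left; apply/esym/anti.
  rewrite (below_monom_eq uL dL cL (hh i) (eh i) le_ji hcL h0) ?lepm_refl // ev.
  by rewrite add0m.
- move=> i; have be := below_monom uL dL cL (hh i) (eh i).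
  have := taylor_cone_neq0 mo (cone_init cL) (hh i) be.
  rewrite -eh taylor_monom /mps_monom eqxx oner_eq0 => /(_ isT) [c [a [hc ea hin ha]]].
  have dai : in_diagram (alpha i) by apply/existsP; exists i; exact: lepm_refl.
  have dc : in_diagram (vtx c).
    apply: contraT => /(notin_diagram_stair cL hc) /stair_notin_diagram /(_ hin).
    by rewrite dai.
  have hcJ : c \in LJ by rewrite mem_filter dc.
  have [_ _ le_c _] := LJP c hcJ.
  have ei : ix c = i by apply: anti; apply: lepm_trans le_c _; rewrite ea lem_addl.
  have ev : vtx c = alpha i.
    apply/mnmP => x; apply/eqP; rewrite eqn_leq; apply/andP; split.
      by move: x; apply/mnm_lepP; rewrite ea lem_addl.
    by move: x; apply/mnm_lepP; rewrite -{1}ei.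
  have a0 : a = 0%MM by apply: (@addIm _ (vtx c)); rewrite add0m -ea ev.
  rewrite /H rmorph_sum big_mkcond (bigD1_seq c) ?filter_uniq //= ei eqxx.
  rewrite [X in _ + X]big1_seq ?addr0 => [|c' /andP [ne hc']].
    have aa : (alpha i - alpha i = 0)%MM by apply/mnmP => x; rewrite mnmBE mnm0E subnn.
    by rewrite rmorphM /= res_monom ev aa eqxx mulr1 resE -a0.
  case: eqP => // ec'; apply/eqP; apply: contraNT ne => /(term i i c' hc' ec') [_ ev'].
  have [hcL' _ _ _] := LJP c' hc'; apply/eqP; apply: dL hcL' hc _ hin.
  by rewrite -ev'; split=> //; exact: lepm_refl.
have fE' i : f i = \sum_j H' i j * \sum_(c <- L | in_diagram (vtx c)) h j c * gen c.
  under eq_bigr => j _ do rewrite fE mulr_sumr.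
  rewrite exchange_big /=.
  under eq_bigr => z _ do under eq_bigr => j _ do rewrite mulrA.
  under eq_bigr => z _ do rewrite -mulr_suml hH'.
  by rewrite (bigD1 i) //= eqxx mul1r big1 ?addr0 // => z; rewrite eq_sym => /negPf ->; rewrite mul0r.
have trans (f1 f2 : 'I_k -> obj C N) (A : 'I_k -> 'I_k -> obj C N) g :
    (forall i, f1 i = \sum_j A i j * f2 j) -> ideal_gen f1 g -> ideal_gen f2 g.
  move=> eA [b ->]; exists (fun j => \sum_i b i * A i j).
  under eq_bigr => i _ do rewrite eA mulr_sumr.
  rewrite exchange_big /=; apply: eq_bigr => j _; rewrite mulr_suml.
  by apply: eq_bigr => i _; rewrite mulrA.
by move=> g; split; apply: trans; [exact: fE | exact: fE'].
Qed.

End Division.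
End Cones.

(** * The two orders on the monomials in (u, v) *)

Record additive_preorder N (le : rel 'X_{1..N}) : Prop := AdditivePreorder {
  ap_trans : transitive le;
  ap_total : total le;
  ap_add : forall c a b, le (a + c)%MM (b + c)%MM = le a b;
  ap_wf : forall P : 'X_{1..N} -> Prop, (exists a, P a) ->
    exists2 a, P a & forall b, P b -> le a b
}.

Lemma finite_min (T : finType) (r : rel T) (P : T -> Prop) : transitive r -> total r ->
  (exists a, P a) -> exists2 a, P a & forall b, P b -> r a b.
Proof.
move=> r_trans r_total [a0 h0]; pose s := sort r [seq x <- enum T | `[< P x >]].
have sP x : P x -> x \in s by move=> h; rewrite mem_sort mem_filter mem_enum andbT; apply/asboolP.
have Ps x : x \in s -> P x by rewrite mem_sort mem_filter => /andP [/asboolP].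
have : sorted r s by exact: sort_sorted.
case: s sP Ps => [|a s] sP Ps; first by have := sP _ h0.
move=> /(order_path_min r_trans) /allP hs; exists a; first by apply: Ps; rewrite inE eqxx.
move=> b /sP; rewrite inE => /orP [/eqP ->|/hs //].
by have := r_total a a; rewrite orbb.
Qed.

Section Weight.
Variables (R : realType) (q n : nat) (T : 'M[R]_(q.+1, n)).
Hypothesis hT : normalized_order T.

Definition weight_le : rel 'X_{1..n} := fun a b => (weight T a <= weight T b)%O.

Let row (i : 'I_q.+1) (a : 'X_{1..n}) : R := \sum_(j < n) T i j * (a j)%:R.

Let rowD i a b : row i (a + b)%MM = row i a + row i b.
Proof.
by rewrite /row -big_split; apply: eq_bigr => j _; rewrite mnmDE natrD mulrDr.
Qed.

Let row0 a : row ord0 a = (mdeg a)%:R.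
Proof.
rewrite mdegE /row natr_sum; apply: eq_bigr => j _.
by have [_ ->] := hT; rewrite mul1r.
Qed.

Let weightE a : val (weight T a) = map (row^~ a) (enum 'I_q.+1).
Proof. by []. Qed.

Let weight_leE a b : weight_le a b =
  (map (row^~ a) (enum 'I_q.+1) <= map (row^~ b) (enum 'I_q.+1) :> seqlexi R)%O.
Proof. by []. Qed.

Lemma weight_le_mdeg a b : weight_le a b -> (mdeg a <= mdeg b)%N.
Proof.
rewrite weight_leE enum_ordSl /= lexi_cons => /andP [h _].
by rewrite -(ler_nat R) -!row0.
Qed.

(** T_1 being the total degree, a minimum need only be sought among the finitely
    many monomials of least degree. *)
Lemma weight_le_preorder : additive_preorder weight_le.
Proof.
have tr : transitive weight_le by move=> b a c; exact: le_trans.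
have tot : total weight_le by move=> a b; exact: le_total.
split=> // [c a b|P [a0 h0]].
  rewrite !weight_leE; elim: (enum _) => //= i s IH.
  by rewrite !lexi_cons IH !rowD !lerD2r.
have ex : exists d, `[< exists a, P a /\ mdeg a = d >].
  by exists (mdeg a0); apply/asboolP; exists a0.
have [d /asboolP [a1 [h1 e1]] mind] := ex_minnP ex.
have [|a ha mina] := @finite_min {: 'X_{1..n < d.+1} } (fun a b => weight_le a b)
    (fun a => P a) (fun b a c => @tr b a c) (fun a b => tot a b).
  have hd1 : (mdeg a1 < d.+1)%N by rewrite e1.
  by exists (BMultinom hd1).
exists (a : 'X_{1..n}) => // b hb; have [hd|hd] := leqP (mdeg b) d.
  exact: (mina (@BMultinom _ d.+1 b hd)).
have [//|] := orP (tot (a : 'X_{1..n}) b) => /weight_le_mdeg.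
by rewrite leqNgt (leq_ltn_trans _ hd) // -ltnS bmdeg.
Qed.

End Weight.

Section Orders.
Variables (n m : nat).

Definition ext (a : 'X_{1..n}) : 'X_{1..n + m} := mpush (lshift m) a.
Definition low (g : 'X_{1..n + m}) : 'X_{1..n} := [multinom g (lshift m i) | i < n].

Lemma ext_l a i : ext a (lshift m i) = a i.
Proof. by rewrite /ext mpush_in //; exact: lshift_inj. Qed.

Lemma ext_r a j : ext a (rshift n j) = 0%N.
Proof. by rewrite /ext mpush_out //; apply/codomP => -[i /eqP]; rewrite eq_rlshift. Qed.

Lemma low_ext a : low (ext a) = a.
Proof. by apply/mnmP => i; rewrite mnmE ext_l. Qed.

Lemma lowD a b : low (a + b) = (low a + low b)%MM.
Proof. by apply/mnmP => i; rewrite !(mnmE, mnmDE). Qed.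

Lemma ext_le a g : (ext a <= g)%MM = (a <= low g)%MM.
Proof.
apply/mnm_lepP/mnm_lepP => h i; first by rewrite mnmE -ext_l.
by case: (split_ordP i) => i' ->; rewrite ?ext_r // ext_l; have := h i'; rewrite mnmE.
Qed.

Lemma mdeg_ext a : mdeg (ext a) = mdeg a.
Proof.
rewrite !mdegE big_split_ord /= [X in (_ + X)%N]big1 ?addn0 => [|j _]; last exact: ext_r.
by apply: eq_bigr => i _; rewrite ext_l.
Qed.

Definition vdeg (g : 'X_{1..n + m}) : nat := (\sum_(j < m) g (rshift n j))%N.

Lemma vdegD a b : vdeg (a + b) = (vdeg a + vdeg b)%N.
Proof. by rewrite /vdeg -big_split; apply: eq_bigr => j _; rewrite mnmDE. Qed.

Lemma vdeg_ext a : vdeg (ext a) = 0%N.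
Proof. by rewrite /vdeg big1 // => j _; rewrite ext_r. Qed.

Lemma vdeg_eq0 g : vdeg g = 0%N -> g = ext (low g).
Proof.
move=> /eqP; rewrite sum_nat_eq0 => /forallP h; apply/mnmP => i.
by case: (split_ordP i) => j ->; rewrite ?ext_l ?ext_r ?mnmE //; apply/eqP; exact: h.
Qed.

Definition lex_le N (phi : 'X_{1..N} -> nat) (le : rel 'X_{1..N}) : rel 'X_{1..N} :=
  fun a b => (phi a < phi b)%N || ((phi a == phi b) && le a b).

Lemma lex_le_preorder N (phi : 'X_{1..N} -> nat) le :
  (forall a b, phi (a + b)%MM = phi a + phi b)%N ->
  additive_preorder le -> additive_preorder (lex_le phi le).
Proof.
move=> phiD [tr tot ad wf]; split.
- move=> b a c; rewrite /lex_le => /orP [h1|/andP [/eqP -> h1]] /orP [h2|/andP [/eqP e2 h2]].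
  + by rewrite (ltn_trans h1 h2).
  + by rewrite -e2 h1.
  + by rewrite h2.
  + by rewrite e2 eqxx (tr _ _ _ h1 h2) orbT.
- by move=> a b; rewrite /lex_le; case: ltngtP => //= _; exact: tot.
- by move=> c a b; rewrite /lex_le !phiD ltn_add2r eqn_add2r ad.
move=> P [a0 h0].
have ex : exists d, `[< exists a, P a /\ phi a = d >].
  by exists (phi a0); apply/asboolP; exists a0.
have [d /asboolP [a1 h1] mind] := ex_minnP ex.
have [a [ha ea] mina] := wf (fun a => P a /\ phi a = d) (ex_intro _ a1 h1).
exists a => // b hb; rewrite /lex_le ea.
have : (d <= phi b)%N by apply: mind; apply/asboolP; exists b.
by rewrite leq_eqVlt => /orP [/eqP e|->//]; rewrite e eqxx mina ?orbT.
Qed.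

Variables (R : realType) (q : nat) (T : 'M[R]_(q.+1, n)).
Hypothesis hT : normalized_order T.

Definition low_le : rel 'X_{1..n + m} := fun a b => weight_le T (low a) (low b).
(** Ordering by the v-degree first makes the initial monomial of f that of f(u,0). *)
Definition v_le := lex_le vdeg low_le.
(** Refining the total degree instead bounds the order of the remainders. *)
Definition deg_le := lex_le (@mdeg (n + m)) v_le.

Let v_pre : additive_preorder v_le.
Proof.
apply: lex_le_preorder; first exact: vdegD.
have [tr tot ad wf] := weight_le_preorder hT.
split=> [b a c|a b|c a b|P [a0 h0]]; rewrite /low_le ?lowD //.
- exact: tr.
- have [_ [a ha <-] mina] := wf (fun x => exists2 a, P a & low a = x)
    (ex_intro _ (low a0) (ex_intro2 _ _ a0 h0 erefl)).
  by exists a => // b hb; apply: mina; exists b.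
Qed.

Let vE a : vdeg a = 0%N -> mdeg (low a) = 0%N -> a = 0%MM.
Proof.
move=> /vdeg_eq0 -> /eqP; rewrite low_ext mdeg_eq0 => /eqP ->.
by apply/mnmP => i; case: (split_ordP i) => j ->; rewrite ?ext_l ?ext_r ?mnm0E.
Qed.

Lemma v_le_order : monomial_order v_le.
Proof.
have [tr tot ad wf] := v_pre; split=> // a.
have v0 : vdeg 0%MM = 0%N by rewrite /vdeg big1 // => j _; rewrite mnm0E.
rewrite /v_le /lex_le v0 /= => /andP [/eqP va /(weight_le_mdeg hT)].
have -> : low 0%MM = 0%MM by apply/mnmP => i; rewrite mnmE !mnm0E.
by rewrite mdeg0 leqn0 => /eqP; exact: vE.
Qed.

Lemma deg_le_order : monomial_order deg_le.
Proof.
have [tr tot ad wf] := lex_le_preorder (@mdegD _) v_pre; split=> // a.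
by rewrite /deg_le /lex_le mdeg0 /= => /andP [/eqP /eqP]; rewrite mdeg_eq0 => /eqP.
Qed.

Lemma deg_le_mdeg a b : deg_le a b -> (mdeg a <= mdeg b)%N.
Proof. by move=> /orP [/ltnW//|/andP [/eqP ->]]. Qed.

Variables (K : fieldType) (C : smooth_category K).

Lemma umonomE (a : 'X_{1..n}) : umonom C m a = monom C (ext a).
Proof.
rewrite /umonom /monom big_split_ord /= [X in _ = _ * X]big1 ?mulr1 => [|j _].
  by apply: eq_bigr => i _; rewrite ext_l.
by rewrite ext_r expr0.
Qed.

(** f differs from the pullback of f(u, 0) by an element of the ideal (v), which
    has no monomial in u alone. *)
Lemma restr_taylor (f : obj C (n + m)) a : taylor (restr f : obj C n) a = taylor f (ext a).
Proof.
pose f0 : obj C (n + m) := coord (lshift m) (restr f : obj C n).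
have e0 : restr (f - f0) = 0 :> obj C n by rewrite rmorphB /= restr_coord subrr.
have [h eh] := proj1 (restr_ker _) e0.
rewrite -[f in RHS](subrK f0) eh taylorD taylor_sum big1 ?add0r => [|j _].
  by rewrite /f0 /ext coord_taylor //; exact: lshift_inj.
rewrite -[var _]expr1 taylorMvarX mulm1n lep1mP ext_r eqxx //.
Qed.

(** Monomials in u alone precede all others for this order. *)
Lemma is_exp_initial (f : obj C (n + m)) a :
  is_exp T (taylor (restr f : obj C n)) a <-> initial v_le (taylor f) (ext a).
Proof.
split=> [[[/eqP h1 h2] h3]|[h1 h2]].
  rewrite restr_taylor in h1; split=> // b hb; rewrite /v_le /lex_le vdeg_ext.
  have [v0|v0] := eqVneq (vdeg b) 0%N; last by right; rewrite ltn0.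
  have eb := vdeg_eq0 v0; rewrite {1}eb.
  have lb : taylor (restr f : obj C n) (low b) <> 0 by rewrite restr_taylor -eb; exact/eqP.
  have [hw|hw] := boolP (low_le b (ext a)); last by right.
  left; congr ext; apply/esym/h3; split=> // c hc; apply: le_trans (h2 c hc).
  by move: hw; rewrite /low_le low_ext.
have le_b b : taylor (restr f : obj C n) b <> 0 -> b = a \/ ~~ weight_le T b a.
  rewrite restr_taylor => /eqP /h2 [/(congr1 low)|]; first by rewrite !low_ext; left.
  by rewrite /v_le /lex_le !vdeg_ext /low_le !low_ext; right.
split; first split.
- by rewrite restr_taylor; exact/eqP.
- move=> b /le_b [->//|]; rewrite /weight_le => hw.
  by have := le_total (weight T a) (weight T b); rewrite (negPf hw) orbF.
move=> b [hb1 hb2]; have [//|] := le_b b hb1.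
by rewrite /weight_le hb2 // restr_taylor; exact/eqP.
Qed.

Lemma initial_deg_le (f : obj C (n + m)) a : initial v_le (taylor f) (ext a) ->
  ideal_pow (maxid C (n + m)) (mdeg a) f -> initial deg_le (taylor f) (ext a).
Proof.
move=> [h1 h2] /taylor_adic hd; split=> // b hb.
have [le_ab|/hd e] := leqP (mdeg a) (mdeg b); last by rewrite e eqxx in hb.
have [|hv] := h2 b hb; first by left.
by right; rewrite /deg_le /lex_le mdeg_ext (negPf hv) andbF orbF -leqNgt.
Qed.

End Orders.

(** * Diagrams of finite type and normal forms *)

Section Diagrams.
Variables (n : nat) (D : 'X_{1..n} -> Prop).
Hypotheses (hD : diagram D) (hfin : finite_type D).

Lemma diagram_up a b : (a <= b)%MM -> D a -> D b.
Proof.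
have [s hs] := hD; move=> le_ab /hs [c hc le_ca]; apply/hs; exists c => //.
exact: lepm_trans le_ca le_ab.
Qed.

Lemma diagram_vertex b : D b -> exists2 a, vertex D a & (a <= b)%MM.
Proof.
move=> hb; have ex : exists d, `[< exists a, [/\ D a, (a <= b)%MM & mdeg a = d] >].
  by exists (mdeg b); apply/asboolP; exists b; split=> //; exact: lepm_refl.
have [d /asboolP [a [ha le_ab <-]] mind] := ex_minnP ex.
exists a => //; split=> // c hc le_ca.
have /mind : `[< exists x, [/\ D x, (x <= b)%MM & mdeg x = mdeg c] >].
  by apply/asboolP; exists c; split=> //; exact: lepm_trans le_ca le_ab.
rewrite -{1}(submK le_ca) mdegD -{2}[mdeg c]add0n leq_add2r leqn0 mdeg_eq0 => /eqP e.
by rewrite -(submK le_ca) e add0m.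
Qed.

(** Clearing the coordinates beyond j one at a time, always paying with the j-th
    one. *)
Lemma finite_type_proj (j : 'I_n) a : D a -> exists p, D (proj j a + U_(j) *+ p)%MM.
Proof.
move=> ha; pose s := filter (fun i : 'I_n => (j < i)%N) (enum 'I_n).
have [p hp] : exists p, D [multinom (if l == j then a l + p
    else if l \in s then 0 else a l)%N | l < n].
  have : all (fun i : 'I_n => (j < i)%N) s by exact: filter_all.
  elim: s => [_|i s' IH /= /andP [lt_ji /IH [p hp]]].
    exists 0%N; apply: (eq_ind _ D ha); apply/mnmP => l; rewrite mnmE addn0.
    by case: eqP => [->|].
  have [p' hp'] := hfin lt_ji hp; exists (p + p')%N; apply: (eq_ind _ D hp').
  apply/mnmP => l; rewrite !mnmE inE.
  case: (eqVneq l j) => [->|ne]; first by rewrite ?eqxx addnA.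
  by case: (eqVneq l i).
exists (a j + p)%N; apply: (eq_ind _ D hp); apply/mnmP => l.
rewrite mnmE mnmDE [proj _ _ _]mnmE mulmnE mnm1E [j == l]eq_sym; case: eqVneq => [->|ne].
  by rewrite ltnn add0n mul1n.
rewrite mul0n addn0 mem_filter mem_enum andbT.
by case: ltngtP => // e; case/eqP: ne; exact/esym/val_inj.
Qed.

End Diagrams.

Section Staircase.
Variables (K : fieldType) (C : smooth_category K) (n m k : nat).
Variables (f : 'I_k -> obj C (n + m)) (D : 'X_{1..n} -> Prop) (alpha : 'I_k -> 'X_{1..n}).
Hypotheses (hD : diagram D) (hvert : forall a, vertex D a <-> exists i, alpha i = a).
Let al i := ext m (alpha i).

Lemma in_diagram_low b : in_diagram al b <-> D (low b).
Proof.
split=> [/existsP [i]|hb].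
  rewrite ext_le => le_a; apply: (diagram_up hD le_a).
  by have [] := proj2 (hvert (alpha i)) (ex_intro _ i erefl).
have [a /hvert [i <-] le_a] := diagram_vertex hb.
by apply/existsP; exists i; rewrite ext_le.
Qed.

Lemma proj_ext l (a : 'X_{1..n}) : proj l (ext m a) = ext m (proj l a).
Proof.
apply/mnmP => i; rewrite projE; case: (split_ordP i) => j ->; last by rewrite !ext_r if_same.
by rewrite !ext_l projE.
Qed.

Lemma low_proj l (g : 'X_{1..n + m}) : low (proj l g) = proj l (low g).
Proof. by apply/mnmP => i; rewrite mnmE !projE mnmE. Qed.

Lemma in_proj_ext l b : in_proj al l (ext m b) <-> exists2 a, D a & proj l a = b.
Proof.
split=> [[g /in_diagram_low hg e]|[a ha <-]].
  by exists (low g) => //; rewrite -low_proj e low_ext.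
by exists (ext m a); [apply/in_diagram_low; rewrite low_ext | rewrite proj_ext].
Qed.

Lemma Gamma_barP l a : proj l a = a -> Gamma_bar D l a <-> ~ in_proj al l (ext m a).
Proof. by rewrite /Gamma_bar in_proj_ext => e; split=> [[]|]. Qed.

Lemma proj_idem N l (a : 'X_{1..N}) : proj l (proj l a) = proj l a.
Proof. by apply/projI => i hi; rewrite projE hi. Qed.

Lemma in_proj_le l l' b : (l <= l')%N -> in_proj al l' b -> in_proj al l (proj l b).
Proof.
move=> le_l [a ha <-]; exists a => //; apply/projI => i hi.
by rewrite projE (leq_trans hi le_l).
Qed.

Lemma AsetP l a : Aset D l.+1 a <-> [/\ proj l.+1 a = a, ~ in_proj al l.+1 (ext m a) &
  in_proj al l (proj l (ext m a))].
Proof.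
rewrite /Aset /= proj_ext; split=> [[h1 h2]|[e h1 h2]].
  have e : proj l.+1 a = a by case: h1.
  split=> //; first exact/Gamma_barP.
  by apply: contrapT => h; apply: h2; apply/Gamma_barP => //; exact: proj_idem.
by split; [exact/Gamma_barP | move/Gamma_barP => /(_ (proj_idem _ _))].
Qed.

Lemma proj_low l (g : 'X_{1..n + m}) : (l <= n)%N -> proj l g = g -> g = ext m (low g).
Proof.
move=> le_ln e; apply/mnmP => i; case: (split_ordP i) => j ->; first by rewrite ext_l mnmE.
by rewrite ext_r -e projE /= ltnNge (leq_trans le_ln) ?leq_addr.
Qed.

Lemma stair_coneP (c : cone C (n + m)) : stair_cone al c -> (lev c <= n)%N ->
  [/\ vtx c = ext m (low (vtx c)), gen c = monom C (vtx c) &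
    exists2 l, lev c = l.+1 & Aset D l.+1 (low (vtx c))].
Proof.
move=> [l [[el eg ep _] h1 h2]] le_n; rewrite el in le_n.
have e := proj_low le_n ep; split=> //; exists l => //.
by apply/AsetP; rewrite -e; split=> //; rewrite -low_proj ep.
Qed.

(** Differentiating h u^mu lowers the first l exponents of mu, l the level of the
    cone, and leaves the other ones arbitrary: this stays outside the diagram,
    whose projection to N^l is closed under increasing exponents. *)
Lemma stair_supd (c : cone C (n + m)) h : stair_cone al c -> coord_from (lev c) h ->
  supd_sub (h * gen c) (fun g => ~ D g).
Proof.
move=> [l [[el -> ep _] hN _]] hh g /hasseM_neq0 [g1 [g2 [-> h1 h2']]].
have /mnm_lepP h2 := hasse_monom h2'; rewrite -/(low _) => /in_diagram_low dg; apply: hN.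
pose b := [multinom (if (i < l.+1)%N then vtx c i else (g1 + g2)%MM i) | i < n + m].
exists b; last by rewrite -ep; apply/projI => i hi; rewrite mnmE hi.
apply: in_diagram_up dg; apply/mnm_lepP => i; rewrite [b i]mnmE; case: ifP => // hi.
have lt_i : (i < lev c)%N by rewrite el.
by rewrite mnmDE (coord_from_hasse_supp hh lt_i h1) h2.
Qed.

End Staircase.

Theorem theorem5p1p3 (R : realType) (K : fieldType) (C : smooth_category K)
    (n m q : nat) (T : 'M[R]_(q.+1, n)) (hT : normalized_order T)
    (k : nat) (f : 'I_k -> obj C (n + m))
    (D : 'X_{1..n} -> Prop) (hD : diagram D) (hDfin : finite_type D)
    (alpha : 'I_k -> 'X_{1..n}) (alpha_inj : injective alpha)
    (hvert : forall a, vertex D a <-> exists i, alpha i = a)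
    (hexp : forall i, is_exp T (taylor (restr (f i))) (alpha i)) :
  exists (fbar r : 'I_k -> obj C (n + m))
         (A : 'I_n -> {fset 'X_{1..n}})
         (c : 'I_k -> 'X_{1..n} -> obj C (n + m)),
    (forall g, ideal_gen fbar g <-> ideal_gen f g) /\
    (forall i, fbar i = umonom C m (alpha i) + r i) /\
    (forall i, is_exp T (taylor (restr (fbar i))) (alpha i)) /\
    (forall i, supd_sub (r i) (fun g => ~ D g)) /\
    (forall j a, a \in A j <-> Aset D j.+1 a) /\
    (forall i j a, a \in A j -> coord_from j.+1 (c i a)) /\
    (forall i, fbar i = umonom C m (alpha i)
       + \sum_(j < n) \sum_(a <- A j) c i a * umonom C m a) /\
    (reduced C ->
       forall i (c' : 'X_{1..n} -> obj C (n + m)),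
         (forall j a, a \in A j -> coord_from j.+1 (c' a)) ->
         fbar i = umonom C m (alpha i)
           + \sum_(j < n) \sum_(a <- A j) c' a * umonom C m a ->
         forall j a, a \in A j -> c' a = c i a) /\
    ((forall i, ord_eq (f i) (mdeg (alpha i))) ->
       forall i, ord_ge (r i) (mdeg (alpha i))).
Proof.
have [k_gt0|k0] := pselect (exists i : 'I_k, True); last first.
  have noD a : ~ D a by move=> /diagram_vertex [b /hvert [i _] _]; case: k0; exists i.
  have no (i : 'I_k) : False by case: k0; exists i.
  exists f, (fun i => 0), (fun=> fset0), (fun _ _ => 0).
  do 4! [split; first by [|move=> i; case: (no i)]].
  split; last by do ?[split]; move=> *; case: (no _); assumption.
  move=> j a; rewrite in_fset0; split=> // -[_ []] /=; split; first exact: proj_idem.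
  by case=> b /noD.
pose al i := ext m (alpha i).
have al_supp i (j : 'I_(n + m)) : (n <= j)%N -> al i j = 0%N.
  by case: (split_ordP j) => j' ->; [rewrite /= leqNgt ltn_ord | rewrite /al ext_r].
have al_fin (j : 'I_(n + m)) a : (j < n)%N -> in_diagram al a ->
    exists d, in_diagram al (proj j a + U_(j) *+ d)%MM.
  move=> hj /(in_diagram_low hD hvert) /(finite_type_proj hDfin (Ordinal hj)) [p hp].
  exists p; apply/(in_diagram_low hD hvert).
  rewrite lowD low_proj; apply: (eq_ind _ D hp); congr (_ + _)%MM.
  by apply/mnmP => i; rewrite [RHS]mnmE !mulmnE !mnm1E.
have anti i j : (al j <= al i)%MM -> j = i.
  rewrite ext_le low_ext => le_ji; apply: alpha_inj.
  have [_ h] := proj2 (hvert (alpha i)) (ex_intro _ i erefl).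
  by apply: h le_ji; have [] := proj2 (hvert (alpha j)) (ex_intro _ j erefl).
have vo := v_le_order m hT; have f_init i := proj1 (is_exp_initial T (f i) (alpha i)) (hexp i).
have [L [uL dL repL cL]] := division (leq_addr m n) al_supp al_fin k_gt0 vo f_init.
have /choice [h hL] : forall i, exists h : cone C (n + m) -> obj C (n + m),
    (forall c, c \in L -> coord_from (lev c) (h c)) /\
    monom C (al i) = \sum_(c <- L) h c * gen c.
  by move=> i; exact: repL.
have hh i := (hL i).1; have eh i := (hL i).2.
have stL c : c \in L -> ~~ in_diagram al (vtx c) -> stair_cone al c by exact: (notin_diagram_stair cL).
have lvL c : c \in L -> (lev c <= n)%N by case/cL.
pose LA := [seq c <- L | ~~ in_diagram al (vtx c)].
have LAP c : c \in LA -> [/\ c \in L, stair_cone al c, vtx c = ext m (low (vtx c)),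
    gen c = monom C (vtx c) & exists2 j : 'I_n, lev c = j.+1 & Aset D j.+1 (low (vtx c))].
  rewrite mem_filter => /andP [dc hc]; have st := stL c hc dc.
  have [e1 e2 [l el hA]] := stair_coneP hD hvert st (lvL c hc).
  have hl : (l < n)%N by rewrite -el lvL.
  by split=> //; exists (Ordinal hl).
have LA_inj c c' : c \in LA -> c' \in LA -> low (vtx c) = low (vtx c') -> c = c'.
  move=> /LAP [hc _ e _ _] /LAP [hc' _ e' _ _] e0; apply: (dL _ _ (vtx c)) => //.
    by split=> //; exact: lepm_refl.
  by rewrite e e0 -e'; split=> //; exact: lepm_refl.
pose A (j : 'I_n) : {fset 'X_{1..n}} :=
  [fset a in [seq low (vtx c) | c <- LA & lev c == j.+1]]%fset.
have AP j a : a \in A j <-> exists c, [/\ c \in LA, lev c = j.+1 & low (vtx c) = a].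
  rewrite !inE /=; split=> [/mapP [c]|[c [hc e <-]]].
    by rewrite mem_filter => /andP [/eqP e hc] ->; exists c.
  by apply/mapP; exists c; rewrite // mem_filter e eqxx.
have sumA (c' : 'X_{1..n} -> obj C (n + m)) :
    \sum_(j < n) \sum_(a <- A j) c' a * umonom C m a
    = \sum_(c <- LA) c' (low (vtx c)) * gen c.
  have AE (j : 'I_n) : perm_eq (A j) [seq low (vtx c) | c <- LA & lev c == j.+1].
    apply: uniq_perm; first exact: fset_uniq.
      rewrite map_inj_in_uniq ?filter_uniq // => c1 c2.
      by rewrite !mem_filter => /andP [_ /andP [d1 h1]] /andP [_ /andP [d2 h2]];
        apply: LA_inj; rewrite mem_filter ?d1 ?d2.
    by move=> a; rewrite !inE.
  under eq_bigr => j _ do rewrite (perm_big _ (AE j)) big_map big_filter.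
  rewrite (exchange_big_dep xpredT) //= big_seq [RHS]big_seq.
  apply: eq_bigr => c /LAP [_ _ ev eg [j ej _]].
  rewrite (bigD1 j) ?ej //= big1 ?addr0 => [|j' /andP [/eqP e ne]].
    by rewrite eg umonomE -ev.
  by case/eqP: ne; apply: val_inj; case: e.
have /choice [cn hcn] : forall a, exists c, forall c', c' \in LA -> low (vtx c') = a -> c' = c.
  move=> a; have [[c [hc e]]|no] := pselect (exists c, c \in LA /\ low (vtx c) = a).
    by exists c => c' hc' e'; apply: LA_inj => //; rewrite e e'.
  by exists (0%N, 0%MM, 0) => c' hc' e'; case: no; exists c'.
pose r i := - \sum_(c <- LA) h i c * gen c.
pose coef i a := - h i (cn a).
pose fbar i := \sum_(c <- L | in_diagram al (vtx c)) h i c * gen c.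
have rE i : r i = \sum_(j < n) \sum_(a <- A j) coef i a * umonom C m a.
  rewrite sumA /r -sumrN big_seq [RHS]big_seq; apply: eq_bigr => c hc.
  by rewrite /coef -(hcn _ c) // mulNr.
have fbarE i : fbar i = umonom C m (alpha i) + r i.
  by rewrite umonomE -/(al i) eh (bigID (fun c => in_diagram al (vtx c))) /= -/(fbar i) /r big_filter addrK.
have dal i : in_diagram al (al i) by apply/existsP; exists i; exact: lepm_refl.
exists fbar, r, A, coef; split; [|split; [exact: fbarE|split; [|split; [|split; [|split; [|split; [|split]]]]]]].
- exact: (normal_forms_generate k_gt0 vo f_init uL dL cL hh eh anti).
- move=> i; apply/is_exp_initial.
  exact: (normal_form_initial vo f_init uL dL cL (hh i) (eh i) (dal i)).
- move=> i g hg; have [c [hc hgc]] : exists c, c \in LA /\ hasse g (h i c * gen c) <> 0.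
    apply: contrapT => H; apply: hg; rewrite /r -sumrN big_seq.
    elim/big_rec: _ => [|c x hc IH]; first exact: hasse0.
    rewrite hasseD IH addr0 -mulNr; apply: contrapT => hc'; apply: H; exists c; split=> // e.
    by apply: hc'; have := hasse_linear g (-1) (h i c * gen c) 0;
      rewrite !addr0 hasse0 addr0 e scaler0 scaleN1r -mulNr.
  have [hcL st _ _ _] := LAP c hc.
  exact: (stair_supd hD hvert st (hh i c hcL) hgc).
- move=> j a; rewrite AP; split=> [[c [hc e <-]]|].
    by have [_ _ _ _ [j' ej']] := LAP c hc; move: e; rewrite ej' => -[/val_inj ->].
  move=> /(AsetP m hD hvert) [ea hN hP].
  have [h' [hh' eh']] := repL (monom C (ext m a)).
  have be := below_monom vo f_init uL dL cL hh' eh'.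
  have := taylor_cone_neq0 vo (cone_init vo f_init cL) hh' be.
  rewrite -eh' taylor_monom /mps_monom eqxx oner_eq0 => /(_ isT) [c [b [hc _ hin _]]].
  have dc : ~~ in_diagram al (vtx c).
    apply/negP => dc; apply: hN; apply/(in_proj_ext m hD hvert); exists a => //.
    by rewrite -(low_ext m a); apply/(in_diagram_low hD hvert); exact: in_diagram_up hin.1 dc.
  have hcA : c \in LA by rewrite mem_filter dc.
  have [_ _ ev _ [j' ej' /(AsetP m hD hvert)]] := LAP c hcA.
  rewrite -ev => -[ea' hN' hP'].
  have evp l : (l <= j'.+1)%N -> proj l (ext m a) = proj l (vtx c).
    by move=> hl; apply/projI => i hi; apply: hin.2; rewrite ej' (leq_trans hi).
  have pv : proj j'.+1 (vtx c) = vtx c by rewrite ev proj_ext ea'.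
  have pa : proj j.+1 (ext m a) = ext m a by rewrite proj_ext ea.
  have pp l l' (x : 'X_{1..n + m}) : (l <= l')%N -> proj l (proj l' x) = proj l x.
    by move=> hl; apply/projI => i hi; rewrite projE (leq_trans hi hl).
  (* otherwise a projection of a would lie both inside and outside that of D *)
  have ejj : j = j' :> nat.
    case: (ltngtP j j') => // e.
      case: hN; rewrite -pa -(pp _ _ _ e) (evp j') //; exact: in_proj_le e hP'.
    case: hN'; rewrite -pv -evp // -(pp _ _ _ e); exact: in_proj_le e hP.
  by exists c; split; rewrite // ?ej' -?ejj // -pv -evp // -ejj pa low_ext.
- move=> i j a /AP [c [hc e1 e2]]; rewrite /coef -(hcn a c) // -e1.
  by apply: coord_fromN; apply: hh; case: (LAP c hc).
- by move=> i; rewrite fbarE rE.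
- move=> hred i c' hc' e j a /AP [c [hc e1 e2]].
  rewrite /coef -(hcn a c) //; apply/eqP; rewrite -addr_eq0 -e2.
  pose h2 c := c' (low (vtx c)) + h i c.
  have uLA : uniq LA by exact: filter_uniq.
  have LAL x : x \in LA -> x \in L by case/LAP.
  have dLA : disjoint_cones LA by move=> c1 c2 g /LAL h1 /LAL h3; exact: dL.
  have iLA x : x \in LA -> initial (v_le T) (taylor (gen x)) (vtx x).
    by move=> /LAL; exact: (cone_init vo f_init cL).
  have hh2 x : x \in LA -> coord_from (lev x) (h2 x).
    move=> hx; apply: coord_fromD; last by apply: hh; exact: LAL.
    by have [_ _ _ _ [j' ej' _]] := LAP x hx; rewrite ej'; apply/hc'/AP; exists x.
  have g0 : \sum_(x <- LA) h2 x * gen x = 0.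
    move: e; rewrite fbarE => /addrI; rewrite sumA /r => e.
    by under eq_bigr => x _ do rewrite mulrDl; rewrite big_split /= -e addNr.
  have be b : below (v_le T) LA h2 b.
    apply: (below_initial vo uLA dLA iLA hh2) => b'.
    by rewrite g0 raddf0 -[_ b']/(0 : K) eqxx.
  suff t0 : taylor (h2 c) = 0 by apply/eqP/hred/taylor_ker.
  apply: funext => b; apply/eqP; apply: contraT => hb.
  have := taylor_cone vo uLA dLA iLA hh2 (be _) hc erefl (in_coneD hh2 hc hb).
  rewrite g0 raddf0 -[LHS]/(0 : K) => /esym/eqP.
  by rewrite mulf_eq0 (negPf hb) (negPf (iLA c hc).1).
move=> hord i; exists (mdeg (alpha i)) => //; apply/taylor_adic => g hg.
have f_init' j := initial_deg_le (f_init j) (hord j).1.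
apply/eqP; apply: contraT; rewrite /r raddfN -[X in X != 0]/(- taylor _ g) oppr_eq0 big_filter.
move=> /(remainder_below (deg_le_order m hT) f_init' uL dL cL (hh i) (eh i)) [/deg_le_mdeg].
by rewrite mdeg_ext leqNgt hg.
Qed.
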